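(* Let $n$ tend to infinity along some infinite sequence of positive integers (all asymptotic notation and all limits below are along this sequence), let $G=G(n,0.5)$, put $f(k)=\binom{n}{k}2^{-\binom{k}{2}}$ and let $k_0=k_0(n)$ be the largest integer $k$ such that $f(k)\ge 1$. Then the following hold. (i) If $f(k_0)\to\infty$ (that is, $1=o(f(k_0))$) and $f(k_0+1)=o(1)$, then whp $\alpha(G)=k_0$ and $\beta(G)=k_0+2$. Therefore, in this case $\tau(G)\le n-\alpha(G)-1$ whp. (ii) If $f(k_0)=\Theta(1)$, then whp one of the following four possibilities holds, and each of them holds with probability that is bounded away from $0$ and $1$: (a) $\alpha(G)=k_0$ and $\beta(G)=k_0+2$; (b) $\alpha(G)=k_0$ and $\beta(G)=k_0+1$; (c) $\alpha(G)=k_0-1$ and $\beta(G)=k_0+2$; (d) $\alpha(G)=k_0-1$ and $\beta(G)=k_0+1$. (iii) If $f(k_0+1)=\Theta(1)$, then whp one of the following four possibilities holds, and each of them holds with probability that is bounded away from $0$ and $1$: (a) $\alpha(G)=k_0+1$ and $\beta(G)=k_0+3$; (b) $\alpha(G)=k_0+1$ and $\beta(G)=k_0+2$; (c) $\alpha(G)=k_0$ and $\beta(G)=k_0+3$; (d) $\alpha(G)=k_0$ and $\beta(G)=k_0+2$.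
   Context: $G(n,p)$ is the random graph on $n$ labeled vertices in which each pair of vertices is an edge independently with probability $p$. ''With high probability'' (whp) means with probability tending to $1$ as $n$ tends to infinity. For a graph $G$: $\alpha(G)$ is the maximum size of an independent set of $G$; $\beta(G)$ is the largest number of vertices in an induced subgraph of $G$ that is a complete bipartite graph (with two nonempty vertex classes); $\tau(G)$ is the minimum number of pairwise edge disjoint complete bipartite subgraphs of $G$ (not necessarily induced) such that each edge of $G$ belongs to exactly one of them. ''Bounded away from $0$ and $1$'' means that the probability lies in $[\varepsilon,1-\varepsilon]$ for some $\varepsilon>0$ independent of $n$, for all sufficiently large $n$ in the sequence. *)

(* Defs.v *)
From HB Require Import structures.
From mathcomp Require Import all_boot all_order all_algebra.
Set Implicit Arguments.
Unset Strict Implicit.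
Unset Printing Implicit Defensive.
Import Order.TTheory GRing.Theory Num.Theory.

Section Graphs.
Variable T : finType.

Definition vpairs : {set {set T}} := [set e : {set T} | #|e| == 2].

(* A simple graph on T is identified with its edge set. *)
Definition sgraph := {E : {set {set T}} | E \subset vpairs}.
HB.instance Definition _ := Finite.on sgraph.

Definition edges (G : sgraph) : {set {set T}} := val G.

Definition independent (G : sgraph) (A : {set T}) : bool :=
  [forall e in edges G, ~~ (e \subset A)].

Definition alpha (G : sgraph) : nat :=
  \max_(A : {set T} | independent G A) #|A|.

Definition cross (A B : {set T}) : {set {set T}} :=
  [set [set x; y] | x in A, y in B].

Definition induces_biclique (G : sgraph) (A B : {set T}) : bool :=
  [&& A != set0, B != set0, [disjoint A & B] &
      [set e in edges G | e \subset A :|: B] == cross A B].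

(* The maximum is 0 when G has no edge. *)
Definition beta (G : sgraph) : nat :=
  \max_(P : {set T} * {set T} | induces_biclique G P.1 P.2) #|P.1 :|: P.2|.

(* A biclique has no isolated vertex, so as a subgraph of G it is determined
   by its edge set. *)
Definition biclique_edges (F : {set {set T}}) : bool :=
  [exists A : {set T}, exists B : {set T},
    [&& A != set0, B != set0, [disjoint A & B] & F == cross A B]].

Definition biclique_decomposition (G : sgraph) (D : {set {set {set T}}}) :=
  partition D (edges G) && [forall F in D, biclique_edges F].

Definition single_edges (G : sgraph) : {set {set {set T}}} :=
  [set [set e] | e in edges G].

Definition tau (G : sgraph) : nat :=
  #|[arg min_(D < single_edges G | biclique_decomposition G D) #|D|]|.

(* The minimum defining tau is not over an empty set. *)
Lemma single_edgesP (G : sgraph) : biclique_decomposition G (single_edges G).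
Proof.
apply/andP; split.
  apply/and3P; split.
  - rewrite /cover /single_edges; apply/eqP/setP => e.
    apply/bigcupP/idP => [[F /imsetP[e' e'G ->]] /set1P -> //|eG].
    by exists [set e]; [apply/imsetP; exists e|rewrite inE].
  - apply/trivIsetP => F1 F2 /imsetP[e1 _ ->] /imsetP[e2 _ ->] neq.
    rewrite disjoints1 inE; apply: contra neq => /eqP -> //.
  - apply/imsetP => -[e _ /setP/(_ e)]; by rewrite !inE eqxx.
apply/forall_inP => F /imsetP[e eG ->].
have : e \in vpairs by apply: (subsetP (valP G)).
rewrite inE => /cards2P[x [y [xy ->]]].
apply/existsP; exists [set x]; apply/existsP; exists [set y].
rewrite -!card_gt0 !cards1 /= disjoints1 inE xy /=.
by apply/eqP; rewrite /cross imset2_set1l imset_set1.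
Qed.

Lemma tauP (G : sgraph) (m : nat) :
  (tau G <= m)%N <-> exists2 D, biclique_decomposition G D & (#|D| <= m)%N.
Proof.
rewrite /tau; case: arg_minnP => [|D DG Dmin]; first exact: single_edgesP.
split=> [Dm|[D' D'G D'm]]; first by exists D.
exact: leq_trans (Dmin _ D'G) D'm.
Qed.

End Graphs.

(* Imported only here: the notions of classical sets would shadow those of
   finite sets used above. *)
From mathcomp Require Import all_classical all_reals all_analysis.
Import numFieldNormedType.Exports.
Local Open Scope ring_scope.

Section Gnp.
Variable R : realType.

(* The law of G(n, p) gives a graph the product, over all pairs of vertices,
   of p for an edge and 1 - p for a non-edge. *)
Definition Gnp_prob (p : R) (n : nat) (A : pred (sgraph 'I_n)) : R :=
  \sum_(G : sgraph 'I_n | A G)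
    \prod_(e in vpairs 'I_n) (if e \in edges G then p else 1 - p).

Lemma Gnp_edges (p : R) (n : nat) (S : {set {set 'I_n}}) :
  S \subset vpairs 'I_n ->
  Gnp_prob p (fun G => S \subset edges G) = p ^+ #|S|.
Proof.
move=> SV; pose V := vpairs 'I_n.
pose f e : R := if e \in V then p else 0.
pose g e : R := if e \in V then (if e \in S then 0 else 1 - p) else 1.
have -> : p ^+ #|S| = \prod_e (f e + g e).
  rewrite -prodr_const (bigID (mem S) predT) /= [X in _ * X]big1 ?mulr1.
    by apply: eq_bigr => e eS; rewrite /f /g (fintype.subsetP SV) // eS addr0.
  move=> e /negPf eS; rewrite /f /g eS; case: ifP => _; last by rewrite add0r.
  by rewrite addrC subrK.
rewrite bigA_distr /=.
rewrite (bigID (fun J : {set {set 'I_n}} => (J \subset V) && (S \subset J))) /=.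
rewrite [X in _ + X]big1 ?addr0; last first.
  move=> J; rewrite negb_and => /orP[] /fintype.subsetPn[e e1 /negPf e2].
    by rewrite (bigD1 e) //= e1 /f e2 mul0r.
  by rewrite (bigD1 e) //= e2 /g (fintype.subsetP SV) // e1 mul0r.
rewrite /Gnp_prob /edges.
pose F (J : {set {set 'I_n}}) : R :=
  \prod_(e in V) (if e \in J then p else 1 - p).
rewrite (@reindex_omap _ _ _ _ _ val (insub : _ -> option (sgraph 'I_n))) /=.
  apply: eq_big => [G|G SG].
    by rewrite (valP G) /= valK eqxx !andbT.
  rewrite [in RHS](bigID (mem V)) /= [X in _ * X]big1 ?mulr1.
    apply: eq_bigr => e eV; rewrite /f /g eV.
    by case: ifP => // /negbT eG; rewrite ifN //; apply: contra eG; apply: (fintype.subsetP SG).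
  move=> e /negPf eV; rewrite /f /g eV ifN //.
  by apply/negP => /(fintype.subsetP (valP G)); rewrite -/V eV.
by move=> J /andP[JV _]; rewrite insubT.
Qed.

(* In particular the weights sum to 1 and distinct pairs are independent. *)
Lemma Gnp_total (p : R) (n : nat) : Gnp_prob p (fun _ : sgraph 'I_n => true) = 1.
Proof.
have := Gnp_edges p (finset.sub0set (vpairs 'I_n)); rewrite cards0 expr0 => <-.
by apply: eq_bigl => G; rewrite finset.sub0set.
Qed.

Definition whp (p : R) (nu : nat -> nat) (A : forall n, pred (sgraph 'I_n)) :
    Prop :=
  ((fun i => Gnp_prob p (A (nu i))) @ \oo --> (1 : R))%classic.

Definition bounded_away (u : nat -> R) : Prop :=
  exists2 eps : R, 0 < eps & (\forall i \near \oo, eps <= u i <= 1 - eps)%classic.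

Definition fk (n k : nat) : R := 'C(n, k)%:R * 2 ^- 'C(k, 2).

(* f(k) vanishes for k > n, so that the range of the maximum is harmless. *)
Definition k0 (n : nat) : nat := \max_(k < n.+1 | 1 <= fk n k) k.

Lemma k0P (n : nat) :
  1 <= fk n (k0 n) /\ (forall k, 1 <= fk n k -> (k <= k0 n)%N).
Proof.
split.
  rewrite /k0; have [|i fi ->] := @eq_bigmax_cond _
      (fun k : 'I_n.+1 => 1 <= fk n k) (fun k => k : nat).
    apply/card_gt0P; exists ord0.
    by rewrite /in_mem /= /fk bin0 expr0 invr1 mulr1.
  exact: fi.
move=> k fk1; have kn : (k < n.+1)%N.
  rewrite ltnS leqNgt; apply/negP => nk; move: fk1.
  by rewrite /fk bin_small // mul0r ler10.
exact: (@leq_bigmax_cond _ _ (fun k : 'I_n.+1 => k : nat) (Ordinal kn)).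
Qed.

End Gnp.

Definition alpha_beta_eq (a b : nat -> nat) (n : nat) (G : sgraph 'I_n) : bool :=
  (alpha G == a n) && (beta G == b n).

(* Main.v *)
Require Import Defs.
From mathcomp Require Import all_boot all_order all_algebra.
From mathcomp Require Import zify ring lra.
Set Implicit Arguments.
Unset Strict Implicit.
Unset Printing Implicit Defensive.
Import Order.TTheory GRing.Theory Num.Theory.

(** Write f(k) for the expected number of independent k-sets of G(n, 1/2).  For
    k near 2 log2 n the ratio f(k+1)/f(k) is about n/(k 2^k), which is n^(-1+o(1)):
    f falls from very large to very small values within two or three steps, so
    that alpha is confined to one value when f jumps over 1 and to two values
    when f(k) is of order 1.  The expected number of induced bicliques on k+2
    vertices is (2^(k+1) - 1) f(k+2), and f(k+2) is about (n/k)^2 2^(-2k) f(k);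
    as f(k) of order 1 means n of order k 2^(k/2), this number has the order of
    f(k) itself (lemmas [plus2_upper] and [plus2_lower]).  Hence beta behaves
    like alpha, shifted by two.  Finally a biclique on beta vertices together
    with a star at each remaining vertex gives tau <= n - beta + 1
    ([tau_le_beta]).

    An independent set is treated as a bicoloured set with one colour class
    empty, so that independent sets and bicliques are events of the same kind:
    for a vertex set W and a subset C, the edges inside W are exactly the pairs
    with one end in C ([bicoloured]).  Such an event depends only on the pairs
    inside W, and it has probability 2^-binom(|W|, 2).

    The first moment bounds alpha and beta from above.  From below, the second
    moment is used: the pairs of events whose sets share r >= 2 vertices
    contribute, relatively to the square of the mean, binom(s,r) binom(t,r)
    divided by the expected number of coloured r-sets, and the sum of these
    quantities over r is governed by its last term ([overlap_sum_small]).

    When f(k) is of order 1, four combinations of the events X = (some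
    independent k-set exists) and Y = (some induced biclique on k+2 vertices
    exists) must be shown to have probability bounded below.  No limit law is
    needed for that.
    - Neither X nor Y: the Lovasz local lemma ([local_lemma]), since each event
      depends on events of small total probability; this replaces correlation
      inequalities, which are not available because avoiding induced bicliques
      is not a monotone property.
    - X and not Y: let N count the independent k-sets.  By Cauchy-Schwarz the
      probability is at least E[N; not Y]^2 / E[N^2], and E[N; not Y] is almost
      E[N] P(not Y), because a given independent set is independent of almost
      all bicliques ([occurs_and_avoids]).  The event Y without X is symmetric.
    - X and Y: the same argument with Y in place of its complement
      ([occurs_and_occurs]). *)

(** * Uniform probability, the local lemma and the second moment *)

Local Open Scope ring_scope.

Section UniformProbability.
Variables (R : realFieldType) (O : finType).
Hypothesis O_gt0 : (0 < #|O|)%N.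
Implicit Types (h : O -> R) (A B : pred O).

Definition Ex h : R := (\sum_x h x) / #|O|%:R.
Definition Pr A : R := Ex (fun x => (A x)%:R).

Let cardO_gt0 : 0 < #|O|%:R :> R. Proof. by rewrite ltr0n. Qed.

Lemma Ex_le h h' : (forall x, h x <= h' x) -> Ex h <= Ex h'.
Proof.
by move=> hh'; rewrite ler_pM2r ?invr_gt0 //; apply: ler_sum => x _.
Qed.

Lemma Ex_eq h h' : h =1 h' -> Ex h = Ex h'.
Proof. by move=> hh'; congr (_ / _); apply: eq_bigr. Qed.

Lemma Ex_sum (I : finType) (F : pred I) (h : I -> O -> R) :
  Ex (fun x => \sum_(i | F i) h i x) = \sum_(i | F i) Ex (h i).
Proof. by rewrite /Ex exchange_big /= mulr_suml. Qed.

Lemma ExD h h' : Ex (fun x => h x + h' x) = Ex h + Ex h'.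
Proof. by rewrite /Ex big_split /= mulrDl. Qed.

Lemma ExZ a h : Ex (fun x => a * h x) = a * Ex h.
Proof. by rewrite /Ex -mulr_sumr mulrA. Qed.

Lemma Ex1 : Ex (fun=> 1) = 1.
Proof. by rewrite /Ex sumr_const mulfV ?gt_eqF. Qed.

Lemma Pr_le A B : (forall x, A x -> B x) -> Pr A <= Pr B.
Proof.
by move=> AB; apply: Ex_le => x; rewrite ler_nat; case: (A x) (AB x) => // ->.
Qed.

Lemma Pr_eq A B : A =1 B -> Pr A = Pr B.
Proof. by move=> AB; apply: Ex_eq => x; rewrite AB. Qed.

Lemma Pr_ge0 A : 0 <= Pr A.
Proof. by rewrite divr_ge0 ?sumr_ge0 ?ler0n. Qed.

Lemma Pr1 : Pr predT = 1.
Proof. exact: Ex1. Qed.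

Lemma Pr_le1 A : Pr A <= 1.
Proof. by rewrite -Pr1; apply: Pr_le. Qed.

Lemma PrC A : Pr (fun x => ~~ A x) = 1 - Pr A.
Proof.
rewrite -Pr1; apply/eqP; rewrite eq_sym subr_eq -ExD; apply/eqP/Ex_eq => x /=.
by case: (A x); rewrite ?addr0 ?add0r.
Qed.

Lemma Pr_split A B : Pr B = Pr (fun x => A x && B x) + Pr (fun x => ~~ A x && B x).
Proof.
by rewrite -ExD; apply: Ex_eq => x; case: (A x); rewrite /= ?addr0 ?add0r.
Qed.

Lemma Pr_sub A B D : (forall x, A x -> B x || D x) -> Pr A <= Pr B + Pr D.
Proof.
move=> ABD; rewrite -ExD; apply: Ex_le => x; rewrite -natrD ler_nat.
by case: (A x) (ABD x) => //; case: (B x); case: (D x) => //= /(_ isT).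
Qed.

Lemma Pr_union_sum (I : finType) (F : pred I) (E : I -> pred O) A :
  (forall x, A x -> exists2 i, F i & E i x) -> Pr A <= \sum_(i | F i) Pr (E i).
Proof.
move=> AE; rewrite -Ex_sum; apply: Ex_le => x.
case Ax: (A x); last by rewrite sumr_ge0.
by have [i Fi Ei] := AE x Ax; rewrite (bigD1 i) //= Ei lerDl sumr_ge0.
Qed.

Section Events.
Variables (I : finType) (E : I -> pred O) (dep : rel I).
Implicit Types (i j : I) (F J : {set I}).

Definition avoids F : pred O := fun x => [forall j in F, ~~ E j x].
Definition occurs F : pred O := fun x => [exists j in F, E j x].

(* dep is the dependency relation of the local lemma: E i is independent of
   the whole family of the E j that it is not related to. *)
Hypothesis indep : forall i J, (forall j, j \in J -> ~~ dep i j) ->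
  Pr (fun x => E i x && avoids J x) = Pr (E i) * Pr (avoids J).

Definition weight F : R := \sum_(i in F) Pr (E i).
Definition overlap F J : R :=
  \sum_(i in F) \sum_(j in J | dep i j) Pr (fun x => E i x && E j x).

Lemma occursN F x : occurs F x = ~~ avoids F x.
Proof. by rewrite /occurs /avoids negb_forall_in; apply: eq_existsb => j; rewrite negbK. Qed.

Lemma weight_ge0 F : 0 <= weight F.
Proof. by apply: sumr_ge0 => i _; apply: Pr_ge0. Qed.

Lemma overlap_ge0 F J : 0 <= overlap F J.
Proof. by apply: sumr_ge0 => i _; apply: sumr_ge0 => j _; apply: Pr_ge0. Qed.

Lemma Pr_occurs_le F : Pr (occurs F) <= weight F.
Proof. by apply: Pr_union_sum => x /existsP[i /andP[iF Ei]]; exists i. Qed.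

Lemma avoids_le F J x : J \subset F -> avoids F x -> avoids J x.
Proof.
move=> /subsetP JF /forall_inP nF; apply/forall_inP => j jJ; exact/nF/JF.
Qed.

(** Inside J, first discard the events that E i depends on: E i is independent
    of the avoidance of the others.  Putting the discarded events back costs at
    most a factor 2, since by induction each of them occurs with conditional
    probability at most 2 Pr (E j), in total at most 1/2. *)
(** The symmetric Lovasz local lemma: by the chain rule, with each conditional
    probability at most 2 Pr (E i). *)
Lemma local_lemma_step i F : (forall i, i \in F -> \sum_(j in F | dep i j) Pr (E j) <= 4^-1) ->
  forall J, J \subset F -> i \in F ->
  Pr (fun x => E i x && avoids J x) <= 2 * Pr (E i) * Pr (avoids J).
Proof.
move=> loc J; have [m] := ubnP #|J|; elim: m J i => // m IHm J i ltJ JF iF.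
pose J2 := [set j in J | ~~ dep i j].
have J2J : J2 \subset J by apply/subsetP => j; rewrite inE => /andP[].
have ub : Pr (fun x => E i x && avoids J x) <= Pr (E i) * Pr (avoids J2).
  rewrite -indep; last by move=> j; rewrite inE => /andP[].
  by apply: Pr_le => x /andP[-> /(avoids_le J2J)].
have [eJ|neJ] := eqVneq J2 J.
  rewrite eJ in ub; apply: le_trans ub _; rewrite -mulrA ler_peMl //.
    by rewrite mulr_ge0 ?Pr_ge0.
  by rewrite ler1n.
have ltJ2 : (#|J2| < m)%N.
  by apply: leq_trans (ltJ : (#|J| <= m)%N); apply: proper_card; rewrite properEneq neJ.
have lb : Pr (avoids J2) <= Pr (avoids J) + \sum_(j in J | dep i j) Pr (fun x => E j x && avoids J2 x).
  apply: le_trans (_ : Pr (avoids J) + Pr (fun x => ~~ avoids J x && avoids J2 x) <= _).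
    apply: Pr_sub => x n2; by case: (avoids J x) => //=.
  rewrite lerD2l; apply: Pr_union_sum => x /andP[nJ n2].
  move: nJ; rewrite /avoids negb_forall_in => /existsP[j /andP[jJ]]; rewrite negbK => Ej.
  exists j; last by rewrite Ej.
  rewrite jJ; apply: contraTT Ej => ndep.
  by move/forall_inP: n2; apply; rewrite inE jJ.
have sb : \sum_(j in J | dep i j) Pr (fun x => E j x && avoids J2 x)
    <= 2^-1 * Pr (avoids J2).
  apply: le_trans (_ : \sum_(j in J | dep i j) 2 * Pr (E j) * Pr (avoids J2) <= _).
    apply: ler_sum => j /andP[jJ _]; apply: IHm => //.
      exact: subset_trans JF.
    exact: (subsetP JF).
  rewrite -mulr_suml ler_wpM2r ?Pr_ge0 // -mulr_sumr.
  apply: (@le_trans _ _ (2 * \sum_(j in F | dep i j) Pr (E j))).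
    rewrite ler_pM2l //; rewrite [leRHS](bigID [pred j | j \in J]) /=.
    rewrite (_ : \sum_(j in J | dep i j) Pr (E j) =
        \sum_(j | (j \in F) && dep i j && (j \in J)) Pr (E j)).
      by rewrite lerDl sumr_ge0 // => j _; apply: Pr_ge0.
    apply: eq_bigl => j; case jJ: (j \in J); rewrite ?andbF ?andbT //=.
    by rewrite (subsetP JF).
  by have := loc i iF; lra.
apply: le_trans ub _; apply: (@le_trans _ _ (Pr (E i) * (2 * Pr (avoids J)))).
  by rewrite ler_wpM2l ?Pr_ge0 //; lra.
by lra.
Qed.

Lemma local_lemma F : {in F, forall i, dep i i} ->
  (forall i, i \in F -> \sum_(j in F | dep i j) Pr (E j) <= 4^-1) ->
  \prod_(i in F) (1 - 2 * Pr (E i)) <= Pr (avoids F).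
Proof.
move=> dep_refl loc.
suff: forall J, J \subset F -> \prod_(i in J) (1 - 2 * Pr (E i)) <= Pr (avoids J).
  exact.
move=> J; have [m] := ubnP #|J|; elim: m J => // m IHm J ltJ JF.
have [->|[i iJ]] := set_0Vmem J.
  by rewrite big_set0 -Pr1; apply: Pr_le => x _; apply/forall_inP => j; rewrite inE.
rewrite (big_setD1 i iJ) /=.
have iF := subsetP JF _ iJ.
have J'F : J :\ i \subset F by apply: subset_trans JF; apply: subsetDl.
have /IHm/(_ J'F) IH : (#|J :\ i| < m)%N by move: ltJ; rewrite (cardsD1 i) iJ.
have pi4 : Pr (E i) <= 4^-1.
  apply: le_trans (loc i iF); rewrite (bigD1 i) ?iF ?dep_refl //= lerDl.
  by apply: sumr_ge0 => j _; apply: Pr_ge0.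
have := local_lemma_step loc J'F iF => cond.
have eN : Pr (avoids (J :\ i)) =
    Pr (fun x => E i x && avoids (J :\ i) x) + Pr (avoids J).
  rewrite (Pr_split (E i)); congr (_ + _); apply: Pr_eq => x.
  apply/andP/idP => [[nEi nJ']|nJ].
    apply/forall_inP => j jJ; have [->//|ji] := eqVneq j i.
    by move/forall_inP: nJ'; apply; rewrite !inE ji.
  split; first by move/forall_inP: nJ; apply.
  by apply: avoids_le nJ; apply: subsetDl.
have := Pr_ge0 (E i) => pi0.
apply: le_trans (_ : (1 - 2 * Pr (E i)) * Pr (avoids (J :\ i)) <= _).
  by rewrite ler_wpM2l //; lra.
by move: cond; lra.
Qed.

Definition count_events F x : R := \sum_(i in F) (E i x)%:R.

Lemma Ex_count F : Ex (count_events F) = weight F.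
Proof. exact: Ex_sum. Qed.

Lemma avoids1 j x : avoids [set j] x = ~~ E j x.
Proof.
apply/forall_inP/idP => [/(_ j (set11 j))//|nE i /set1P -> //].
Qed.

(** Take two independent copies of the random graph and let them swap their
    edges outside D.  This involution of the product space carries the event
    that the first copy has A and B to the event that the first copy has A and
    the second has B. *)
Lemma Pr_indep2 i j : ~~ dep i j ->
  Pr (fun x => E i x && E j x) = Pr (E i) * Pr (E j).
Proof.
move=> ndep; have J j' : j' \in [set j] -> ~~ dep i j' by move=> /set1P ->.
have := indep J.
have -> : Pr (avoids [set j]) = 1 - Pr (E j).
  by rewrite -PrC; apply: Pr_eq => x; rewrite avoids1.
have := Pr_split (E j) (E i).
rewrite (Pr_eq (A := fun x => E i x && avoids _ x) (B := fun x => ~~ E j x && E i x)).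
  rewrite (Pr_eq (A := fun x => E j x && E i x) (B := fun x => E i x && E j x)); first by lra.
  by move=> x; rewrite andbC.
by move=> x; rewrite avoids1 andbC.
Qed.

(** Non-adjacent pairs are independent, so they account for at most the square
    of the mean. *)
Lemma Ex_count2 F :
  Ex (fun x => count_events F x ^+ 2) <= weight F ^+ 2 + overlap F F.
Proof.
have -> : Ex (fun x => count_events F x ^+ 2) =
    \sum_(i in F) \sum_(j in F) Pr (fun x => E i x && E j x).
  rewrite (eq_bigr (fun i => Ex (fun x => \sum_(j in F) (E i x && E j x)%:R))).
    rewrite -Ex_sum; apply: Ex_eq => x; rewrite expr2 mulr_suml.
    apply: eq_bigr => i _; rewrite mulr_sumr; apply: eq_bigr => j _.
    by rewrite -natrM mulnb.
  by move=> i _; rewrite Ex_sum.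
rewrite expr2 /weight /overlap mulr_suml -big_split /=; apply: ler_sum => i iF.
rewrite (bigID (dep i)) /= addrC lerD2r mulr_sumr [leRHS](bigID (dep i)) /= addrC.
apply: (@le_trans _ _ (\sum_(j in F | ~~ dep i j) Pr (E i) * Pr (E j))).
  by apply: ler_sum => j /andP[_ /Pr_indep2 ->].
by rewrite lerDl sumr_ge0 // => j _; rewrite mulr_ge0 ?Pr_ge0.
Qed.

(** Integrating over H the pointwise bound 1 >= 2 t N - t^2 N^2, valid where
    the count N is positive, whose right-hand side vanishes where N = 0.  With H
    trivial this is the usual second moment bound. *)
Lemma second_moment F (H : pred O) b : 0 < weight F -> 0 <= b ->
  b <= Ex (fun x => count_events F x * (H x)%:R) ->
  b ^+ 2 / (weight F ^+ 2 + overlap F F) <= Pr (fun x => occurs F x && H x).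
Proof.
move=> W0 b0 bB; set B := Ex _ in bB; set A := _ + _.
have A0 : 0 < A by rewrite ltr_wpDr ?overlap_ge0 ?exprn_gt0.
(* t maximises 2 t b - t^2 A. *)
pose t := b / A.
have key : 2 * t * B - t ^+ 2 * A <= Pr (fun x => occurs F x && H x).
  apply: (@le_trans _ _ (2 * t * B + - t ^+ 2 * Ex (fun x => count_events F x ^+ 2))).
    by rewrite mulNr lerD2l lerN2 ler_wpM2l ?sqr_ge0 // Ex_count2.
  rewrite -!ExZ -ExD; apply: Ex_le => x.
  have c0 : 0 <= count_events F x by apply: sumr_ge0.
  case HX: (H x); rewrite ?andbF ?andbT ?mulr0 ?mulr1 ?add0r.
    case sX: (occurs F x).
      rewrite /= -subr_ge0 (_ : _ - _ = (1 - t * count_events F x) ^+ 2) ?sqr_ge0 //.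
      by rewrite mulr1n; ring.
    have -> : count_events F x = 0.
      apply: big1 => i iF; case Ei: (E i x) => //.
      by move: sX; rewrite /occurs => /existsP[]; exists i; rewrite iF.
    by rewrite expr0n /= !mulr0 addr0.
  by rewrite mulNr oppr_le0 mulr_ge0 ?sqr_ge0.
apply: le_trans key.
have t0 : 0 <= t by rewrite divr_ge0 // ltW.
have -> : t ^+ 2 * A = b * t by rewrite /t; field; rewrite gt_eqF.
have -> : b ^+ 2 / A = b * t by rewrite /t; field; rewrite gt_eqF.
have := ler_wpM2l t0 bB; lra.
Qed.

Lemma Pr_occurs_ge F : 0 < weight F ->
  weight F ^+ 2 / (weight F ^+ 2 + overlap F F) <= Pr (occurs F).
Proof.
move=> W0; rewrite (Pr_eq (B := fun x => occurs F x && predT x)); last first.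
  by move=> x; rewrite andbT.
apply: second_moment => //; first exact: ltW.
by rewrite -Ex_count; apply: Ex_le => x; rewrite mulr1.
Qed.

Lemma Ex_countH F (H : pred O) :
  Ex (fun x => count_events F x * (H x)%:R) = \sum_(i in F) Pr (fun x => E i x && H x).
Proof.
rewrite -Ex_sum; apply: Ex_eq => x; rewrite mulr_suml; apply: eq_bigr => i _.
by rewrite -natrM mulnb.
Qed.

(** Given E i, the events of J unrelated to i are avoided with the unconditional
    probability or more; a union bound over the related ones costs the
    overlap. *)
Lemma occurs_and_avoids F J : 0 < weight F ->
  overlap F J <= weight F * Pr (avoids J) ->
  (weight F * Pr (avoids J) - overlap F J) ^+ 2 / (weight F ^+ 2 + overlap F F)
  <= Pr (fun x => occurs F x && avoids J x).
Proof.
move=> W0 le; apply: second_moment; rewrite ?subr_ge0 //.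
rewrite Ex_countH /weight /overlap mulr_suml -sumrB; apply: ler_sum => i iF.
pose J2 := [set j in J | ~~ dep i j].
have J2J : J2 \subset J by apply/subsetP => j; rewrite inE => /andP[].
rewrite lerBlDr.
apply: (@le_trans _ _ (Pr (E i) * Pr (avoids J2))).
  by rewrite ler_wpM2l ?Pr_ge0 //; apply: Pr_le => x; apply: avoids_le.
rewrite -indep; last by move=> j; rewrite inE => /andP[].
apply: le_trans (_ : Pr (fun x => E i x && avoids J x) +
  Pr (fun x => E i x && avoids J2 x && ~~ avoids J x) <= _).
  by apply: Pr_sub => x /andP[-> ->] /=; case: (avoids J x).
rewrite lerD2l; apply: Pr_union_sum => x /andP[/andP[Ei n2]].
rewrite /avoids negb_forall_in => /existsP[j /andP[jJ]]; rewrite negbK => Ej.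
exists j; last by rewrite Ei Ej.
rewrite jJ; apply: contraTT Ej => ndep.
by move/forall_inP: n2; apply; rewrite inE jJ.
Qed.

(** Given E i, some event of J unrelated to i still occurs with the
    unconditional probability, up to the total probability eta of those related
    to i. *)
Lemma occurs_and_occurs F J (eta : R) : 0 < weight F ->
  (forall i, i \in F -> \sum_(j in J | dep i j) Pr (E j) <= eta) ->
  eta <= Pr (occurs J) ->
  (weight F * (Pr (occurs J) - eta)) ^+ 2 / (weight F ^+ 2 + overlap F F)
  <= Pr (fun x => occurs F x && occurs J x).
Proof.
move=> W0 loc le; apply: second_moment => //.
  by rewrite mulr_ge0 ?subr_ge0 ?weight_ge0.
rewrite Ex_countH /weight mulr_suml; apply: ler_sum => i iF.
pose J2 := [set j in J | ~~ dep i j].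
have J2J : J2 \subset J by apply/subsetP => j; rewrite inE => /andP[].
have : Pr (fun x => E i x && avoids J2 x) = Pr (E i) * Pr (avoids J2).
  by apply: indep => j; rewrite inE => /andP[].
have PsN K : Pr (occurs K) = 1 - Pr (avoids K).
  by rewrite -PrC; apply: Pr_eq => x; rewrite occursN.
have := Pr_split (occurs J2) (E i).
rewrite (Pr_eq (A := fun x => ~~ occurs J2 x && E i x) (B := fun x => E i x && avoids J2 x)); last first.
  by move=> x; rewrite occursN negbK andbC.
move=> e1 e2.
have l1 : Pr (fun x => occurs J2 x && E i x) <= Pr (fun x => E i x && occurs J x).
  apply: Pr_le => x /andP[s2 ->] /=; rewrite occursN; apply: contraL s2.
  by rewrite occursN negbK; apply: avoids_le.
apply: le_trans l1.
have l2 : Pr (occurs J) <= Pr (occurs J2) + eta.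
  apply: le_trans (_ : Pr (occurs J2) + Pr (fun x => occurs J x && ~~ occurs J2 x) <= _).
    by apply: Pr_sub => x ->; case: (occurs J2 x).
  rewrite lerD2l; apply: le_trans (loc i iF).
  apply: Pr_union_sum => x /andP[/existsP[j /andP[jJ Ej]] n2].
  exists j => //; rewrite jJ; apply: contraTT Ej => ndep.
  move: n2; rewrite occursN negbK => /forall_inP; apply; by rewrite inE jJ.
have := Pr_ge0 (E i) => pi0.
have : Pr (E i) * (Pr (occurs J) - eta) <= Pr (E i) * Pr (occurs J2).
  by rewrite ler_wpM2l // lerBlDr.
rewrite [Pr (occurs J2)]PsN; lra.
Qed.

End Events.
End UniformProbability.

(** * Independent sets and induced bicliques as events of one kind *)

Section RandomGraph.
Variables (R : realFieldType) (T : finType).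
Implicit Types (G : sgraph T) (D Q X : {set {set T}}) (W C : {set T}).

(** The intersection makes the construction total; it changes nothing for a
    set of pairs. *)
Definition graph_of X : sgraph T := exist _ (X :&: vpairs T) (subsetIr _ _).

Lemma edges_graph_of X : edges (graph_of X) = X :&: vpairs T.
Proof. by []. Qed.

Lemma edges_vpairs G e : e \in edges G -> e \in vpairs T.
Proof. exact: (subsetP (valP G)). Qed.

Lemma graph_ext G G' : edges G =i edges G' -> G = G'.
Proof. by move=> eG; apply/val_inj/setP. Qed.

Lemma card_sgraph_gt0 : (0 < #|{: sgraph T}|)%N.
Proof. by apply/card_gt0P; exists (graph_of set0). Qed.

Notation Pr := (Pr R).

Definition mix D G G' : sgraph T := graph_of (edges G :&: D :|: edges G' :\: D).

Lemma in_mix D G G' e :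
  (e \in edges (mix D G G')) = if e \in D then e \in edges G else e \in edges G'.
Proof.
rewrite edges_graph_of !inE; case: ifP => eD; rewrite ?andbT ?andbF ?orbF /=.
  by case eG: (e \in edges G) => //=; have := edges_vpairs eG; rewrite inE.
by case eG: (e \in edges G') => //=; have := edges_vpairs eG; rewrite inE.
Qed.

Definition depends_on D (A : pred (sgraph T)) :=
  forall G G', (forall e, e \in D -> (e \in edges G) = (e \in edges G')) ->
  A G = A G'.

Lemma Pr_indep D (A B : pred (sgraph T)) :
  depends_on D A -> depends_on (~: D) B ->
  Pr (fun G => A G && B G) = Pr A * Pr B.
Proof.
move=> dA dB; pose N := #|{: sgraph T}|%:R : R.
have N0 : N != 0 by rewrite pnatr_eq0 -lt0n card_sgraph_gt0.
rewrite /Pr /Ex mulrACA -invfM -/N; apply: (mulIf (mulf_neq0 N0 N0)).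
rewrite mulfVK ?mulf_neq0 // mulrA mulfVK //.
pose sw (p : sgraph T * sgraph T) := (mix D p.1 p.2, mix D p.2 p.1).
have swK : involutive sw.
  move=> [G G']; rewrite /sw /=; congr (_, _); apply: graph_ext => e;
  by rewrite !in_mix; case: (e \in D).
rewrite mulr_suml mulr_suml.
transitivity (\sum_(G : sgraph T) \sum_(G' : sgraph T) (A G && B G)%:R : R).
  by apply: eq_bigr => G _; rewrite mulr_natr; apply: esym; exact: sumr_const.
transitivity (\sum_(G : sgraph T) \sum_(G' : sgraph T) (A G)%:R * (B G')%:R : R); last first.
  by apply: eq_bigr => G _; rewrite mulr_sumr.
rewrite !pair_big /= [RHS](reindex_inj (inv_inj swK)) /=.
apply: eq_bigr => -[G G'] _ /=; rewrite -natrM mulnb; congr (_ && _)%:R.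
  by apply: dA => e eD; rewrite in_mix eD.
by apply: dB => e; rewrite inE in_mix => /negPf ->.
Qed.

Definition has_pattern D (q : pred {set T}) : pred (sgraph T) :=
  fun G => [forall e in D, (e \in edges G) == q e].

(** Toggling one pair of D exchanges the two possible prescriptions for it, so
    every pair of D halves the probability. *)
Lemma Pr_pattern D q : D \subset vpairs T ->
  Pr (has_pattern D q) = 2^-1 ^+ #|D|.
Proof.
have [m] := ubnP #|D|; elim: m D q => // m IHm D q ltD DV.
have [->|[e eD]] := set_0Vmem D.
  rewrite cards0 expr0 -(Pr1 R card_sgraph_gt0); apply: Pr_eq => G.
  by apply/forall_inP => e; rewrite inE.
have D'V : D :\ e \subset vpairs T by apply: subset_trans DV; apply: subsetDl.
have ltD' : (#|D :\ e| < m)%N by move: ltD; rewrite (cardsD1 e) eD.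
rewrite (cardsD1 e) eD add1n exprS -(IHm _ q ltD' D'V).
pose q' := fun e' => if e' == e then ~~ q e else q e'.
pose flip G := graph_of [set e' | (e' \in edges G) (+) (e' == e)].
have in_flip G e' : (e' \in edges (flip G)) = (e' \in edges G) (+) (e' == e).
  rewrite edges_graph_of !inE andb_idr // => h.
  suff : e' \in vpairs T by rewrite inE.
  by move: h; have [-> _|_] := eqVneq e' e; [apply: (subsetP DV)|rewrite addbF; apply: edges_vpairs].
have flipK : involutive flip.
  by move=> G; apply: graph_ext => e'; rewrite !in_flip -addbA addbb addbF.
have split_e r G : has_pattern D r G = ((e \in edges G) == r e) && has_pattern (D :\ e) r G.
  apply/forall_inP/andP => [h|[h1 /forall_inP h2] e' e'D].
    by split; [exact: h|apply/forall_inP => e'; rewrite !inE => /andP[_]; apply: h].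
  by have [->//|ne] := eqVneq e' e; apply: h2; rewrite !inE ne.
have qq' G : has_pattern (D :\ e) q' G = has_pattern (D :\ e) q G.
  by apply: eq_forallb => e'; rewrite !inE /q'; case: (e' == e).
have flipq G : has_pattern D q (flip G) = has_pattern D q' G.
  rewrite !split_e qq' in_flip eqxx /q' eqxx; congr (_ && _).
    by case: (e \in _); case: (q e).
  by apply: eq_forallb => e'; rewrite !in_setD1 in_flip; case: (e' == e); rewrite //= addbF.
have PP : Pr (has_pattern D q) = Pr (has_pattern D q').
  rewrite /Pr /Ex (reindex_inj (inv_inj flipK)); congr (_ / _).
  by apply: eq_bigr => G _; rewrite flipq.
have : Pr (has_pattern (D :\ e) q) = Pr (has_pattern D q) + Pr (has_pattern D q').
  rewrite (Pr_split R (fun G => has_pattern D q G)); congr (_ + _); apply: Pr_eq => G.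
    by rewrite split_e -andbA andbb.
  rewrite !split_e qq' /q' eqxx; case: (has_pattern _ _ _); rewrite ?andbF ?andbT //.
  by case: (e \in _); case: (q e).
by rewrite -PP; lra.
Qed.

Definition pairs_in W : {set {set T}} := [set e : {set T} | e \subset W & #|e| == 2].

Lemma card_pairs_in W : #|pairs_in W| = 'C(#|W|, 2).
Proof. exact: cards_draws. Qed.

Lemma pairs_in_vpairs W : pairs_in W \subset vpairs T.
Proof. by apply/subsetP => e; rewrite !inE => /andP[]. Qed.

Lemma pairs_inI W W' : pairs_in W :&: pairs_in W' = pairs_in (W :&: W').
Proof. by apply/setP => e; rewrite !inE subsetI; case: (#|e| == 2); rewrite ?andbF ?andbT. Qed.

(** If i.2 is empty this says that i.1 is independent; if it is a proper
    non-empty subset of i.1, that i.1 induces a biclique with classes i.2 and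
    the rest of i.1. *)
Definition bicoloured (i : {set T} * {set T}) : pred (sgraph T) :=
  has_pattern (pairs_in i.1) (fun e => #|e :&: i.2| == 1).

(** Two vertex sets with fewer than two common vertices have no common pair. *)
Definition meet2 : rel ({set T} * {set T}) := fun i j => (1 < #|i.1 :&: j.1|)%N.

Lemma bicoloured_indep i (J : {set {set T} * {set T}}) :
  (forall j, j \in J -> ~~ meet2 i j) ->
  Pr (fun G => bicoloured i G && avoids bicoloured J G) =
  Pr (bicoloured i) * Pr (avoids bicoloured J).
Proof.
move=> nJ; apply: (@Pr_indep (pairs_in i.1)) => G G' eG.
  by apply: eq_forallb => e; case eD: (e \in pairs_in i.1) => //=; rewrite eG.
apply: eq_forallb => j; case jJ: (j \in J) => //=; congr (~~ _).
apply: eq_forallb => e; case eD: (e \in pairs_in j.1) => //=; rewrite eG //.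
rewrite inE; apply: contra (nJ j jJ) => eDi.
have : e \in pairs_in (i.1 :&: j.1) by rewrite -pairs_inI inE eDi eD.
by rewrite inE => /andP[/subset_leq_card]; rewrite /meet2 => + /eqP e2; rewrite e2.
Qed.

Lemma Pr_bicoloured i : Pr (bicoloured i) = 2^-1 ^+ 'C(#|i.1|, 2).
Proof. by rewrite Pr_pattern ?pairs_in_vpairs // card_pairs_in. Qed.

(** On the common vertices a bicolouring is determined by the graph up to
    exchanging the colours. *)
Definition consistent (i j : {set T} * {set T}) : bool :=
  let U := i.1 :&: j.1 in
  (j.2 :&: U == i.2 :&: U) || (j.2 :&: U == U :\: i.2).

Lemma card_pairI (x y : T) C : x != y ->
  (#|[set x; y] :&: C| == 1) = (x \in C) (+) (y \in C).
Proof.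
move=> xy; rewrite setIUl cardsU.
have -> : [set x] :&: C :&: ([set y] :&: C) = set0.
  apply/setP => z; rewrite !inE; apply/negP => /andP[/andP[/eqP -> _] /andP[/eqP e _]].
  by rewrite e eqxx in xy.
rewrite cards0 subn0.
have c1 z : #|[set z] :&: C| = (z \in C).
  case zC: (z \in C); last by apply/eqP; rewrite cards_eq0 setI_eq0 disjoints1 zC.
  by rewrite (setIidPl _) ?cards1 // sub1set.
by rewrite !c1; case: (x \in C); case: (y \in C).
Qed.

Lemma bicolouredP (i : {set T} * {set T}) G :
  reflect {in i.1 &, forall x y, x != y ->
     ([set x; y] \in edges G) = (x \in i.2) (+) (y \in i.2)}
   (bicoloured i G).
Proof.
apply: (iffP forall_inP) => [h x y xW yW xy|h e].
  rewrite -card_pairI //; apply/eqP/h.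
  by rewrite inE subUset !sub1set xW yW cards2 xy.
rewrite inE => /andP[eW /cards2P[x [y [xy ee]]]].
move: eW; rewrite ee subUset !sub1set => /andP[xW yW].
by rewrite card_pairI // h.
Qed.

(** Fix a common vertex x: whether y has the colour of x is read off from the
    adjacency of x and y, for both bicolourings. *)
Lemma bicoloured_consistent i j G :
  bicoloured i G -> bicoloured j G -> consistent i j.
Proof.
move=> /bicolouredP hi /bicolouredP hj; rewrite /consistent.
have [->|[x]] := set_0Vmem (i.1 :&: j.1); first by rewrite !setI0 eqxx.
rewrite inE => /andP[xi xj].
have key y : y \in i.1 -> y \in j.1 ->
    (x \in i.2) (+) (y \in i.2) = (x \in j.2) (+) (y \in j.2).
  move=> yi yj; have [->|xy] := eqVneq x y; first by rewrite !addbb.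
  by rewrite -hi // -hj.
case e: ((x \in i.2) == (x \in j.2)); apply/orP; [left|right]; apply/eqP/setP => y;
  rewrite !inE; case yi: (y \in i.1); rewrite ?andbF //=;
  case yj: (y \in j.1); rewrite ?andbF ?andbT //=; have := key y yi yj; move: e;
  by case: (x \in i.2); case: (x \in j.2); case: (y \in i.2); case: (y \in j.2).
Qed.

(** The pairs of common vertices are prescribed once instead of twice. *)
Lemma Pr_bicoloured2 i j :
  Pr (fun G => bicoloured i G && bicoloured j G) <=
  (consistent i j)%:R *
  (2^-1 ^+ 'C(#|i.1|, 2) * 2^-1 ^+ 'C(#|j.1|, 2) * 2 ^+ 'C(#|i.1 :&: j.1|, 2)).
Proof.
case: (pickP (fun G => bicoloured i G && bicoloured j G)) => [G /andP[hi hj]|none]; last first.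
  rewrite (Pr_eq R (B := pred0)) //; rewrite /Pr /Ex big1 // mul0r.
  by rewrite mulr_ge0 ?ler0n // !mulr_ge0 ?exprn_ge0 ?invr_ge0 ?ler0n.
rewrite (bicoloured_consistent hi hj) mul1r.
apply: le_trans (_ : Pr (has_pattern (pairs_in i.1 :|: pairs_in j.1) (fun e => e \in edges G)) <= _).
  apply: (Pr_le R card_sgraph_gt0) => G' /andP[/forall_inP h1 /forall_inP h2].
  apply/forall_inP => e; rewrite inE => /orP[] eD.
    by rewrite (eqP (h1 e eD)) (eqP (forall_inP hi e eD)).
  by rewrite (eqP (h2 e eD)) (eqP (forall_inP hj e eD)).
rewrite Pr_pattern ?subUset ?pairs_in_vpairs //.
have := cardsUI (pairs_in i.1) (pairs_in j.1).
rewrite pairs_inI !card_pairs_in -exprD => <-.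
by rewrite exprD -mulrA -exprMn mulVf ?pnatr_eq0 // expr1n mulr1.
Qed.

End RandomGraph.

Local Close Scope ring_scope.

(** * Families of such events, and how much they overlap *)

Section Families.
Variable T : finType.
Implicit Types (A U W C Q : {set T}) (i j : {set T} * {set T}) (t : nat)
  (F : {set {set T} * {set T}}).

Definition independent_family t : {set {set T} * {set T}} :=
  [set i : {set T} * {set T} | (#|i.1| == t) && (i.2 == set0)].
(** Both (W, C) and (W, W :\: C) are members, so every induced biclique is
    counted twice; this is harmless, as only orders of magnitude matter. *)
Definition biclique_family t : {set {set T} * {set T}} :=
  [set i : {set T} * {set T} |
    [&& #|i.1| == t, i.2 \subset i.1, i.2 != set0 & i.2 != i.1]].

(** What the overlap estimates need to know about a family: theta is the number
    of colours that a vertex outside U may take, 1 for independent sets and 2 for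
    bicliques. *)
Definition spread t theta F :=
  (forall i, i \in F -> #|i.1| = t) /\
  forall U Q, (#|U| <= t)%N ->
    (#|[set i in F | (U \subset i.1) && (i.2 :&: U == Q)]| <=
     'C(#|T| - #|U|, t - #|U|) * theta ^ (t - #|U|))%N.

Lemma card_fibred (P : pred {set T}) (S : {set T} -> {set {set T}}) m :
  (forall W, P W -> #|S W| = m) ->
  #|[set i : {set T} * {set T} | P i.1 && (i.2 \in S i.1)]| = (#|[set W | P W]| * m)%N.
Proof.
move=> Sm.
transitivity (\sum_(W | P W) \sum_(C | C \in S W) 1)%N.
  by rewrite pair_big_dep /= sum1dep_card.
under eq_bigr => W PW do rewrite sum1_card Sm //.
by rewrite sum_nat_const cardsE.
Qed.

Lemma card_sub_pairs A u :
  #|[set i : {set T} * {set T} | [&& i.1 \subset A, #|i.1| == u & i.2 \subset i.1]]|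
  = ('C(#|A|, u) * 2 ^ u)%N.
Proof.
rewrite -cards_draws -(@card_fibred (fun W => (W \subset A) && (#|W| == u)) (@powerset T)).
  by apply: eq_card => i; rewrite !inE andbA.
by move=> W /andP[_ /eqP Wu]; rewrite card_powerset Wu.
Qed.

Lemma independent_family_spread t : spread t 1 (independent_family t).
Proof.
split=> [i|U Q Ut]; first by rewrite inE => /andP[/eqP].
rewrite exp1n muln1 -[X in (X - _)%N]cardsT -cardsDS ?subsetT // setTD -cards_draws.
rewrite -(@card_in_imset _ _ (fun i => i.1 :\: U)).
  apply/subset_leq_card/subsetP => W /imsetP[i]; rewrite !inE.
  move=> /andP[/andP[/eqP i1 _] /andP[Ui _]] ->.
  by rewrite cardsDS // i1 eqxx andbT setDE subsetIr.
move=> [W C] [W' C']; rewrite !inE /= => /andP[/andP[_ /eqP ->] /andP[UW _]].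
move=> /andP[/andP[_ /eqP ->] /andP[UW' _]] e; congr (_, _).
by rewrite -(setID W U) -(setID W' U) e (setIidPr UW) (setIidPr UW').
Qed.

(** The colouring being given on U, a member is determined by its trace outside
    U. *)
Lemma biclique_family_spread t : spread t 2 (biclique_family t).
Proof.
split=> [i|U Q Ut]; first by rewrite inE => /andP[/eqP].
rewrite -[X in (X - _)%N]cardsT -cardsDS ?subsetT // setTD -card_sub_pairs.
rewrite -[leqLHS](@card_in_imset _ _ (fun i => (i.1 :\: U, i.2 :\: U))).
  apply/subset_leq_card/subsetP => W /imsetP[i]; rewrite !inE.
  move=> /andP[/and4P[/eqP i1 i2 _ _] /andP[Ui _]] -> /=.
  by rewrite cardsDS // i1 eqxx !setDE subsetIr setSI.
move=> [W C] [W' C']; rewrite !inE /= => /andP[_ /andP[UW /eqP CQ]].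
move=> /andP[_ /andP[UW' /eqP CQ']] [e1 e2]; congr (_, _).
  by rewrite -(setID W U) -(setID W' U) e1 (setIidPr UW) (setIidPr UW').
by rewrite -(setID C U) -(setID C' U) e2 CQ CQ'.
Qed.

Lemma card_independent_family t : #|independent_family t| = 'C(#|T|, t).
Proof.
rewrite -[#|T|]cardsT -cards_draws.
transitivity #|[set i : {set T} * {set T} | (#|i.1| == t) && (i.2 \in [set set0])]|.
  by apply: eq_card => i; rewrite !inE.
rewrite (@card_fibred (fun W => #|W| == t) (fun=> [set set0]) 1%N) ?muln1.
  by apply: eq_card => W; rewrite !inE subsetT.
by move=> W _; rewrite cards1.
Qed.

Lemma card_biclique_family t : (0 < t)%N ->
  #|biclique_family t| = ('C(#|T|, t) * (2 ^ t - 2))%N.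
Proof.
move=> t0; rewrite -[#|T|]cardsT -cards_draws.
pose S W := powerset W :\ set0 :\ W.
transitivity #|[set i : {set T} * {set T} | (#|i.1| == t) && (i.2 \in S i.1)]|.
  apply: eq_card => i; rewrite !inE.
  by case: (_ == t); case: (_ \subset _); case: (_ == set0); case: (i.2 == i.1).
rewrite (@card_fibred (fun W => #|W| == t) S (2 ^ t - 2)%N).
  by congr muln; apply: eq_card => W; rewrite !inE subsetT.
move=> W /eqP Wt; have := card_powerset W.
rewrite (cardsD1 set0) inE sub0set /= (cardsD1 W) !inE subxx andbT.
rewrite -/(S W) Wt (_ : W != set0); last by rewrite -card_gt0 Wt.
by move=> <-; rewrite add1n add1n subn2.
Qed.

End Families.

Local Open Scope ring_scope.

Section Overlaps.
Variables (R : realFieldType) (T : finType).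
Implicit Types (U W C Q : {set T}) (i j : {set T} * {set T}) (t theta : nat)
  (F : {set {set T} * {set T}}).

Let n := #|T|.
Let Pb i : R := Pr R (bicoloured i).

(** This is the f(k) of random graph theory; over a real type it coincides with
    [fk], see [fkE]. *)
Definition expected (n k : nat) : R := 'C(n, k)%:R * 2^-1 ^+ 'C(k, 2).

Lemma mul_bin_bin (m k r : nat) : (r <= k <= m)%N ->
  ('C(m, k) * 'C(k, r) = 'C(m, r) * 'C(m - r, k - r))%N.
Proof.
move=> /andP[rk km].
have f0 a : (0 < a`!)%N := fact_gt0 a.
have e1 := bin_fact km; have e2 := bin_fact rk.
have e3 := bin_fact (leq_trans rk km).
have e4 : ('C(m - r, k - r) * ((k - r)`! * (m - k)`!) = (m - r)`!)%N.
  by rewrite -(@bin_fact (m - r) (k - r)) ?leq_sub2r // (_ : m - r - (k - r) = m - k)%N //; lia.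
apply/eqP; rewrite -(eqn_pmul2r (f0 r)) -(eqn_pmul2r (f0 (k - r)%N)) -(eqn_pmul2r (f0 (m - k)%N)).
apply/eqP; transitivity (m`!).
  by rewrite -e1 -e2; ring.
by rewrite -e3 -e4; ring.
Qed.

Lemma expected_gt0 (m k : nat) : (k <= m)%N -> 0 < expected m k.
Proof. by move=> km; rewrite mulr_gt0 ?ltr0n ?bin_gt0 // exprn_gt0 // invr_gt0. Qed.

(** On the left, the expected number of members through r given vertices when
    the pairs of these vertices are already as prescribed.  As
    binom(n,t) binom(t,r) = binom(n,r) binom(n-r,t-r), it is the mean times
    binom(t,r) over the expected number of coloured r-sets. *)
Lemma spread_ratio t theta r : (0 < theta)%N -> (r <= t <= n)%N ->
  ('C(n - r, t - r) * theta ^ (t - r))%:R * 2^-1 ^+ 'C(t, 2) * 2 ^+ 'C(r, 2) =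
  expected n t * theta%:R ^+ t * ('C(t, r)%:R / (expected n r * theta%:R ^+ r)) :> R.
Proof.
move=> theta0 rtn; have /andP[rt tn] := rtn.
have th : theta%:R != 0 :> R by rewrite pnatr_eq0 -lt0n.
have h : 2^-1 ^+ 'C(r, 2) * 2 ^+ 'C(r, 2) = 1 :> R.
  by rewrite -exprMn mulVf ?expr1n // pnatr_eq0.
have Cr : 'C(n, r)%:R != 0 :> R.
  by rewrite pnatr_eq0 -lt0n bin_gt0 (leq_trans rt tn).
have e := congr1 (fun x : nat => x%:R : R) (mul_bin_bin rtn).
rewrite /= !natrM in e.
rewrite /expected natrM natrX -(subnK rt) exprD subnK //.
set a := 2^-1 ^+ _ in h *; set b := 2 ^+ _ in h *.
have b0 : b != 0 by rewrite expf_neq0 // pnatr_eq0.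
have -> : a = b^-1 by apply: (mulIf b0); rewrite h mulVf.
have -> : 'C(n - r, t - r)%:R = 'C(n, t)%:R * 'C(t, r)%:R / 'C(n, r)%:R :> R.
  by rewrite e mulrAC mulfV // mul1r.
field; rewrite Cr b0 expf_neq0 //.
Qed.

(** The r-th term measures the pairs of sets, of sizes s and t, with r common
    vertices, relatively to the square of the mean. *)
Definition overlap_sum (m s t theta : nat) : R :=
  \sum_(2 <= r < s.+1) 'C(s, r)%:R * 'C(t, r)%:R / (expected m r * theta%:R ^+ r).

Lemma sum_subsets (A : {set T}) (g : nat -> R) :
  \sum_(U : {set T} | (U \subset A) && (1 < #|U|)%N) g #|U| =
  \sum_(2 <= r < #|A|.+1) 'C(#|A|, r)%:R * g r.
Proof.
transitivity (\sum_(2 <= r < #|A|.+1) \sum_(U : {set T} | (U \subset A) && (#|U| == r)) g r).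
  rewrite (exchange_big_dep (fun U => U \subset A)) /=; last by move=> r U _ /andP[].
  rewrite big_mkcondr; apply: eq_bigr => U UA.
  rewrite UA /= (eq_bigl (fun r => r == #|U|)); last by move=> r; rewrite eq_sym.
  by rewrite big_nat1_eq ltnS (subset_leq_card UA) andbT.
apply: eq_bigr => r _; rewrite sumr_const mulr_natl -cards_draws.
by congr (_ *+ _); apply: eq_card => U; rewrite !inE.
Qed.

(** Group the j by the set U of vertices they share with i.  The colouring of U
    by i leaves only two colourings of U by j, whence the factor 2. *)
Lemma overlap_at_le t theta F i : (0 < theta)%N -> spread t theta F ->
  (#|i.1| <= t <= n)%N ->
  \sum_(j in F | meet2 i j) Pr R (fun G => bicoloured i G && bicoloured j G) <=
  Pb i * (2 * (expected n t * theta%:R ^+ t) * overlap_sum n #|i.1| t theta).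
Proof.
move=> theta0 [Ft sp] /andP[st tn]; set s := #|i.1|.
pose b U : R := 2^-1 ^+ 'C(t, 2) * 2 ^+ 'C(#|U|, 2).
pose S U : {set {set T} * {set T}} := [set j in F | (U == i.1 :&: j.1) && consistent i j].
have cardS U : U \subset i.1 ->
    (#|S U| <= 2 * ('C(n - #|U|, t - #|U|) * theta ^ (t - #|U|)))%N.
  move=> Ui; have Ut : (#|U| <= t)%N by apply: leq_trans (subset_leq_card Ui) st.
  pose X Q := [set j in F | (U \subset j.1) && (j.2 :&: U == Q)].
  apply: (@leq_trans #|X (i.2 :&: U) :|: X (U :\: i.2)|).
    apply/subset_leq_card/subsetP => j; rewrite !inE => /andP[-> /andP[/eqP eU]].
    have -> : U \subset j.1 by rewrite eU subsetIr.
    by rewrite /consistent -eU.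
  by rewrite mul2n -addnn; apply: leq_trans (leq_card_setU _ _) (leq_add _ _); apply: sp.
apply: (@le_trans _ _ (Pb i * \sum_(U : {set T} | (U \subset i.1) && (1 < #|U|)%N) #|S U|%:R * b U)).
  rewrite mulr_sumr (partition_big (fun j => i.1 :&: j.1)
     (fun U : {set T} => (U \subset i.1) && (1 < #|U|)%N)) /=; last first.
    by move=> j /andP[_ m]; rewrite subsetIl.
  apply: ler_sum => U /andP[Ui U2].
  rewrite -sumr_const mulr_suml mulr_sumr.
  under [leRHS]eq_bigr do rewrite mul1r.
  apply: (@le_trans _ _ (\sum_(j in F | meet2 i j && (i.1 :&: j.1 == U))
     (consistent i j)%:R * (Pb i * b U))).
    rewrite (eq_bigl (fun j => (j \in F) && (meet2 i j && (i.1 :&: j.1 == U)))) /=; last first.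
      by move=> j; rewrite andbA.
    apply: ler_sum => j /andP[jF /andP[_ /eqP eU]].
    have := Pr_bicoloured2 R i j; rewrite eU (Ft j jF); congr (_ <= _).
    by rewrite /b /Pb Pr_bicoloured !mulrA.
  rewrite big_mkcond [leRHS]big_mkcond; apply: ler_sum => j _; rewrite inE.
  have p0 : 0 <= Pb i * b U.
    by rewrite mulr_ge0 ?Pr_ge0 // mulr_ge0 // exprn_ge0 // invr_ge0.
  case jF: (j \in F) => //=; rewrite eq_sym; case: (_ == _); rewrite ?andbF //=.
  by case: (meet2 i j); case: (consistent i j); rewrite //= ?mul1r ?mul0r.
rewrite ler_wpM2l ?Pr_ge0 //.
apply: (@le_trans _ _ (\sum_(U : {set T} | (U \subset i.1) && (1 < #|U|)%N)
   2 * (expected n t * theta%:R ^+ t) * ('C(t, #|U|)%:R / (expected n #|U| * theta%:R ^+ #|U|)))).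
  apply: ler_sum => U /andP[Ui U2]; rewrite -mulrA -spread_ratio //; last first.
    by rewrite tn (leq_trans (subset_leq_card Ui) st).
  rewrite /b mulrA mulrA ler_wpM2r ?exprn_ge0 // mulrA ler_wpM2r ?exprn_ge0 ?invr_ge0 //.
  by rewrite -natrM ler_nat cardS.
rewrite -mulr_sumr ler_wpM2l //.
  by rewrite !mulr_ge0 ?exprn_ge0 ?invr_ge0.
rewrite (sum_subsets i.1 (fun r => 'C(t, r)%:R / (expected n r * theta%:R ^+ r))).
by apply: ler_sum => r _; rewrite mulrA.
Qed.

(** Choose two common vertices; the factor 4 counts the colourings of this
    pair. *)
Lemma dependent_weight_le t theta F i : (0 < theta)%N -> spread t theta F -> (2 <= t <= n)%N ->
  \sum_(j in F | meet2 i j) Pb j <=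
  4 * (expected n t * theta%:R ^+ t) * ('C(#|i.1|, 2)%:R * 'C(t, 2)%:R / 'C(n, 2)%:R).
Proof.
move=> theta0 [Ft sp] t2n; have /andP[t2 tn] := t2n.
have pt j : j \in F -> Pb j = 2^-1 ^+ 'C(t, 2) by move=> jF; rewrite /Pb Pr_bicoloured (Ft j jF).
have h0 : 0 <= 2^-1 ^+ 'C(t, 2) :> R by rewrite exprn_ge0 // invr_ge0.
pose P2 (U : {set T}) := (U \subset i.1) && (#|U| == 2).
pose X U := [set j in F | U \subset j.1].
have cardX U : #|U| = 2 -> (#|X U| <= 4 * ('C(n - 2, t - 2) * theta ^ (t - 2)))%N.
  move=> U2; apply: (@leq_trans (\sum_(Q in powerset U) #|[set j in F | (U \subset j.1) && (j.2 :&: U == Q)]|)%N).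
    rewrite -sum1_card (partition_big (fun j => j.2 :&: U) (mem (powerset U))) /=; last first.
      by move=> j _; rewrite inE subsetIr.
    by apply: leq_sum => Q _; rewrite -sum1_card; apply: eq_leq; apply: eq_bigl => j; rewrite !inE andbA.
  rewrite (_ : 4 = #|powerset U|)%N; last by rewrite card_powerset U2.
  by rewrite -sum_nat_const; apply: leq_sum => Q _; have := sp U Q; rewrite U2; apply.
apply: (@le_trans _ _ (\sum_(U | P2 U) \sum_(j in X U) Pb j)).
  rewrite (exchange_big_dep (mem F)) /=; last by move=> U j _; rewrite inE => /andP[].
  rewrite big_mkcondr; apply: ler_sum => j jF; rewrite /meet2.
  have s0 (Q : pred {set T}) : 0 <= \sum_(U | Q U) Pb j.
    by apply: sumr_ge0 => U _; apply: Pr_ge0.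
  case: ifP => // /card_gt1P[x [y [xI yI xy]]].
  move: xI yI; rewrite !inE => /andP[xi xj] /andP[yi yj].
  rewrite (bigD1 [set x; y]) /=; first by rewrite lerDl.
  by rewrite /P2 inE jF !subUset !sub1set xi xj yi yj cards2 xy.
apply: (@le_trans _ _ (\sum_(U | P2 U) 4 * ('C(n - 2, t - 2) * theta ^ (t - 2))%:R * 2^-1 ^+ 'C(t, 2))).
  apply: ler_sum => U /andP[_ /eqP U2].
  rewrite (eq_bigr (fun=> 2^-1 ^+ 'C(t, 2))); last by move=> j; rewrite inE => /andP[/pt].
  rewrite sumr_const -[leLHS]mulr_natl ler_wpM2r // -natrM ler_nat; exact: cardX.
rewrite sumr_const -[leLHS]mulr_natl.
have -> : #|P2| = 'C(#|i.1|, 2) by rewrite -cards_draws; apply: eq_card => U; rewrite !inE.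
have := spread_ratio theta0 t2n; rewrite /expected binn expr1.
set a := ('C(n - 2, t - 2) * theta ^ (t - 2))%:R; set L := _ * _ ^+ t => e.
have a0 : 0 <= a by rewrite ler0n.
have L0 : 0 <= L by rewrite !mulr_ge0 ?exprn_ge0 ?invr_ge0.
have C0 : (0 : R) < 'C(n, 2)%:R by rewrite ltr0n bin_gt0 (leq_trans t2 tn).
have th1 : (1 : R) <= theta%:R ^+ 2 by rewrite exprn_ege1 // ler1n.
have th0 : (0 : R) < theta%:R ^+ 2 by apply: lt_le_trans th1.
have e2 : a * 2^-1 ^+ 'C(t, 2) = L * ('C(t, 2)%:R / 'C(n, 2)%:R) / theta%:R ^+ 2.
  apply: (mulIf (_ : 2 != 0 :> R)); first by rewrite pnatr_eq0.
  by rewrite e; field; rewrite !gt_eqF // ltr0n.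
rewrite -[4 * a * _]mulrA [a * _]e2.
rewrite [leLHS](_ : _ = 4 * L * ('C(#|i.1|, 2)%:R * 'C(t, 2)%:R / 'C(n, 2)%:R) / theta%:R ^+ 2); last first.
  by field; rewrite !gt_eqF // ltr0n.
rewrite ler_pdivrMr // ler_peMr //.
apply: mulr_ge0; first exact: mulr_ge0.
by apply: divr_ge0; rewrite -?natrM ler0n.
Qed.

Lemma weight_spread t theta F : spread t theta F ->
  weight R (@bicoloured T) F = #|F|%:R * 2^-1 ^+ 'C(t, 2).
Proof.
move=> [Ft _]; rewrite /weight (eq_bigr (fun=> 2^-1 ^+ 'C(t, 2))) => [|i iF].
  by rewrite sumr_const mulr_natl.
by rewrite Pr_bicoloured (Ft i iF).
Qed.

Lemma weight_independent_family t :
  weight R (@bicoloured T) (independent_family T t) = expected n t.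
Proof. by rewrite (weight_spread (independent_family_spread T t)) card_independent_family. Qed.

Lemma weight_biclique_family t : (2 <= t)%N ->
  expected n t * 2 ^+ t / 2 <= weight R (@bicoloured T) (biclique_family T t)
    <= expected n t * 2 ^+ t.
Proof.
move=> t2; rewrite (weight_spread (biclique_family_spread T t)).
rewrite card_biclique_family; last exact: leq_trans t2.
have p4 : (4 <= 2 ^ t)%N by rewrite -[4%N]/(2 ^ 2)%N leq_exp2l.
rewrite natrM natrB ?(leq_trans _ p4) // natrX /expected.
have : (4 : R) <= 2 ^+ t by rewrite -natrX ler_nat.
set a := 'C(_, _)%:R; set b := _ ^+ 'C(_, _); set c := _ ^+ t => c4.
have ab : 0 <= a * b by rewrite mulr_ge0 ?exprn_ge0 ?invr_ge0.
by apply/andP; split; nra.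
Qed.

Lemma overlapC F J : overlap R (@bicoloured T) (@meet2 T) F J = overlap R (@bicoloured T) (@meet2 T) J F.
Proof.
rewrite /overlap; under eq_bigr do rewrite big_mkcondr.
under [RHS]eq_bigr do rewrite big_mkcondr.
rewrite exchange_big; apply: eq_bigr => j _; apply: eq_bigr => i _.
by rewrite /meet2 setIC; case: ifP => // _; apply: Pr_eq => G; rewrite andbC.
Qed.

Lemma overlap_spread s t theta F J : (0 < theta)%N -> spread t theta J ->
  (forall i, i \in F -> #|i.1| = s) -> (s <= t <= n)%N ->
  overlap R (@bicoloured T) (@meet2 T) F J <=
  weight R (@bicoloured T) F * (2 * (expected n t * theta%:R ^+ t) * overlap_sum n s t theta).
Proof.
move=> theta0 spJ Fs st; rewrite /overlap /weight mulr_suml; apply: ler_sum => i iF.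
have is_ := Fs i iF; rewrite -is_; apply: overlap_at_le => //; by rewrite is_.
Qed.

End Overlaps.

Local Close Scope ring_scope.

(** * The graph parameters in terms of these events *)

Section GraphInvariants.
Variable T : finType.
Implicit Types (G : sgraph T) (A B C U W : {set T}) (k m : nat).

Lemma exists_subset_between U W k : U \subset W -> (#|U| <= k <= #|W|)%N ->
  exists W', [/\ U \subset W', W' \subset W & #|W'| = k].
Proof.
move=> UW /andP[Uk kW].
have : (0 < 'C(#|W :\: U|, k - #|U|))%N by rewrite bin_gt0 cardsDS // leq_sub2r.
rewrite -cards_draws => /card_gt0P[X]; rewrite inE => /andP[XW /eqP cX].
exists (U :|: X); split; first exact: subsetUl.
  by rewrite subUset UW (subset_trans XW) // subsetDl.
rewrite cardsU cX (_ : U :&: X = set0) ?cards0 ?subn0 ?subnKC //.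
apply/eqP; rewrite setI_eq0 disjoint_sym; apply: disjointWl XW _.
by rewrite -setI_eq0 setDE -setIA [~: U :&: U]setIC setICr setI0.
Qed.

Lemma leq_bigmaxP (I : finType) (P : pred I) (F : I -> nat) k : (0 < k)%N ->
  reflect (exists2 i, P i & (k <= F i)%N) (k <= \max_(i | P i) F i)%N.
Proof.
move=> k0; apply: (iffP idP) => [|[i Pi kF]]; last exact: leq_trans kF (leq_bigmax_cond _ Pi).
case: (pickP (fun i => P i && (k <= F i)%N)) => [i /andP[Pi kF] _|none]; first by exists i.
rewrite leqNgt => /negP[]; rewrite -(ltn_predK k0) ltnS; apply/bigmax_leqP => i Pi.
by have := none i; rewrite Pi /=; lia.
Qed.

Lemma independent_bicoloured G A : independent G A = bicoloured (A, set0) G.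
Proof.
apply/forall_inP/bicolouredP => [h x y xA yA xy /=|h e eG].
  rewrite !in_set0 /=; apply/negP => /h; by rewrite subUset !sub1set xA yA.
have : e \in vpairs T by apply: edges_vpairs eG.
rewrite inE => /cards2P[x [y [xy ee]]].
apply/negP; rewrite ee subUset !sub1set => /andP[xA yA].
by have := h x y xA yA xy; rewrite -ee eG !in_set0.
Qed.

Lemma bicoloured_sub G W W' C : W' \subset W ->
  bicoloured (W, C) G -> bicoloured (W', C :&: W') G.
Proof.
move=> /subsetP W'W /bicolouredP h; apply/bicolouredP => x y /= xW yW xy.
by rewrite h ?W'W // !inE xW yW !andbT.
Qed.

Lemma alpha_geP G k : (k <= alpha G)%N = occurs (@bicoloured T) (independent_family T k) G.
Proof.
apply/idP/existsP => [kG|[[W C]]]; last first.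
  rewrite inE /= => /andP[/andP[/eqP <- /eqP ->]]; rewrite -independent_bicoloured => Wi.
  exact: leq_bigmax_cond.
have [|A Ai eA] := @eq_bigmax_cond _ (independent G) (fun A => #|A|).
  apply/card_gt0P; exists set0; apply/forall_inP => e /edges_vpairs.
  by rewrite inE subset0 -cards_eq0 => /eqP ->.
have [|W [_ WA Wk]] := @exists_subset_between set0 A k (sub0set _).
  by rewrite cards0 -eA.
exists (W, set0); rewrite inE Wk !eqxx /= -(set0I W).
by apply: bicoloured_sub WA _; rewrite -independent_bicoloured.
Qed.

Lemma bicoloured_cross G W (C : {set T}) : C \subset W -> bicoloured (W, C) G ->
  [set e in edges G | e \subset W] = cross C (W :\: C).
Proof.
move=> CW /bicolouredP h; apply/setP => e; rewrite inE.
apply/andP/imset2P => [[eG]|[x y xC]].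
  have : e \in vpairs T by apply: edges_vpairs eG.
  rewrite inE => /cards2P[x [y [xy ee]]]; rewrite ee subUset !sub1set => /andP[xW yW].
  have := h x y xW yW xy; rewrite -ee eG /= => /esym.
  case xC: (x \in C) => /= yC.
    by exists x y; rewrite // inE yC.
  by exists y x; rewrite // ?inE ?xC ?xW // setUC.
rewrite inE => /andP[yC yW] ->.
have xy : x != y by apply: contraNneq yC => <-.
have xW := subsetP CW _ xC.
by rewrite h //= xC (negPf yC) subUset !sub1set xW yW.
Qed.

Lemma cross_bicoloured G A B : [disjoint A & B] ->
  [set e in edges G | e \subset A :|: B] = cross A B -> bicoloured (A :|: B, A) G.
Proof.
move=> dAB /setP h; apply/bicolouredP => x y /= xW yW xy.
have nB z : z \in A :|: B -> (z \in B) = (z \notin A).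
  rewrite inE; case zA: (z \in A) => //= _.
  exact: (disjointFr dAB zA).
have := h [set x; y]; rewrite inE subUset !sub1set xW yW !andbT => ->.
apply/imset2P/idP => [[a b aA bB e]|].
  have bA : b \notin A by rewrite -nB // inE bB orbT.
  have : x \in [set a; b] by rewrite -e !inE eqxx.
  have : y \in [set a; b] by rewrite -e !inE eqxx orbT.
  rewrite !inE => /orP[]/eqP ey /orP[]/eqP ex; move: xy; rewrite ex ey ?eqxx //;
  by rewrite aA (negPf bA).
case xA: (x \in A) => /=; first by move=> yA; exists x y; rewrite // nB.
by move=> yA; exists y x; rewrite ?nB ?xA // setUC.
Qed.

(** Deleting vertices from an induced biclique leaves one as long as each class
    keeps a vertex, so all sizes between 2 and beta occur. *)
Lemma beta_geP G m : (2 <= m)%N ->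
  (m <= beta G)%N = occurs (@bicoloured T) (biclique_family T m) G.
Proof.
move=> m2; apply/leq_bigmaxP/existsP => [|[[A B] /= /and4P[A0 B0 dAB /eqP cr] mAB]|[[W C]]].
- exact: leq_trans m2.
- have [x xA] := set0Pn _ A0; have [y yB] := set0Pn _ B0.
  have sub : [set x; y] \subset A :|: B by rewrite subUset !sub1set !inE xA yB orbT.
  have [|W [xyW WAB Wm]] := exists_subset_between (k := m) sub.
    by rewrite mAB andbT cards2; case: (_ != _) => //; apply: leq_trans m2.
  move: xyW; rewrite subUset !sub1set => /andP[xW yW].
  exists (W, A :&: W); rewrite inE /= Wm eqxx subsetIr /=.
  rewrite (bicoloured_sub WAB) ?cross_bicoloured // andbT; apply/andP; split.
    by apply/set0Pn; exists x; rewrite inE xA.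
  apply/negP => /eqP/setP/(_ y); rewrite inE yW andbT.
  by rewrite (disjointFl dAB yB).
rewrite inE /= => /andP[/and4P[/eqP Wm CW C0 CnW] WC].
have eW : C :|: W :\: C = W by rewrite -{1}(setIidPr CW) setID.
exists (C, W :\: C); last by rewrite /= eW Wm.
rewrite /induces_biclique /= eW C0 (bicoloured_cross CW WC) eqxx andbT /=; apply/andP; split.
  by apply: contra CnW; rewrite setD_eq0 => WsC; rewrite eqEsubset CW.
by rewrite disjoint_sym -setI_eq0 setDE -setIA [~: C :&: C]setIC setICr setI0.
Qed.

(** Use a largest induced biclique, on W say, and a star centred at each vertex
    outside W; an edge with both ends outside W goes to either star. *)
Lemma tau_le_beta G : (0 < beta G)%N -> (tau G + beta G <= #|T| + 1)%N.
Proof.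
move=> b0; have /(leq_bigmaxP _ _ b0)[[A B] /= /and4P[A0 B0 dAB /eqP cr]] := leqnn (beta G).
set W := A :|: B in cr * => bW.
have : (tau G <= #|T| + 1 - #|W|)%N; last first.
  move=> tW; apply: leq_trans (leq_add tW bW) _; rewrite subnK //.
  by apply: leq_trans (leq_addr _ _); apply: max_card.
apply/tauP.
(* the centre of the star that takes e, or None if e lies inside W *)
pose f (e : {set T}) : option T := [pick v in e :\: W].
pose block l := [set e in edges G | f e == l].
exists (preim_partition f (edges G)).
  rewrite /biclique_decomposition preim_partitionP /=; apply/forall_inP => F.
  move=> /imsetP[e0 e0G ->].
  have -> : [set y in edges G | f e0 == f y] = block (f e0).
    by apply/setP => y; rewrite !inE eq_sym.
  case fe: (f e0) => [v|]; last first.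
    apply/existsP; exists A; apply/existsP; exists B.
    rewrite A0 B0 dAB /= -cr; apply/eqP/setP => e; rewrite !inE; congr (_ && _).
    rewrite /f; case: pickP => [v|nv]; rewrite ?inE.
      by move=> /andP[vW ve]; apply/esym/negP => /subsetP/(_ v ve); rewrite inE (negPf vW).
    by apply/esym/subsetP => v ve; have := nv v; rewrite !inE ve andbT => /negbFE.
  have fv (e' : {set T}) : f e' = Some v -> v \in e'.
    by rewrite /f; case: pickP => // u; rewrite inE => /andP[_ ue] [<-].
  have ev (e' : {set T}) : e' \in edges G -> v \in e' -> exists2 u, e' = [set v; u] & u != v.
    move=> /edges_vpairs; rewrite inE => /cards2P[x [y [xy ->]]].
    rewrite !inE => /orP[]/eqP->; first by exists y; rewrite // eq_sym.
    by exists x; rewrite // setUC.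
  pose U := [set u | (u != v) && ([set v; u] \in block (Some v))].
  apply/existsP; exists [set v]; apply/existsP; exists U.
  have -> : [set v] != set0 by rewrite -card_gt0 cards1.
  have -> : U != set0.
    have [u eu uv] := ev _ e0G (fv _ fe).
    by apply/set0Pn; exists u; rewrite !inE uv -eu e0G fe eqxx.
  have -> : [disjoint [set v] & U] by rewrite disjoints1 inE eqxx.
  apply/eqP/setP => e; rewrite /cross imset2_set1l; apply/idP/imsetP => [eb|[u]].
    have := eb; rewrite inE => /andP[eG /eqP /fv ve].
    have [u eu uv] := ev _ eG ve.
    by exists u; rewrite // inE uv -eu.
  by rewrite inE => /andP[_ h] ->.
apply: (@leq_trans #|block @: (None |: [set Some v | v in ~: W])|).
  apply/subset_leq_card/subsetP => F /imsetP[e0 e0G ->].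
  apply/imsetP; exists (f e0); last by apply/setP => y; rewrite !inE eq_sym.
  rewrite !inE /f; case: pickP => [v|//]; rewrite !inE => /andP[vW _].
  by rewrite orFb; apply/imsetP; exists v; rewrite // !inE.
apply: leq_trans (leq_imset_card _ _) _.
rewrite cardsU1 card_imset; last by move=> x y [].
rewrite cardsCs setCK; have WT : (#|W| <= #|T|)%N by exact: max_card.
by rewrite -addnBAC // addnC leq_add2l; case: (_ \notin _).
Qed.

End GraphInvariants.

From mathcomp Require Import all_classical all_reals all_analysis.
Import numFieldNormedType.Exports.
Local Open Scope classical_set_scope.
Local Open Scope ring_scope.

(** * Estimates for the overlap sums *)

Lemma leq_bin_exp n r : ('C(n, r) <= n ^ r)%N.
Proof.
elim: r => [|r IH]; first by rewrite bin0.
rewrite -(leq_pmul2l (ltn0Sn r)) mul_bin_left expnS.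
rewrite mulnCA; apply: (@leq_trans (n * 'C(n, r))); first by rewrite leq_mul2r leq_subr orbT.
by rewrite leq_mul2l; case: (n == 0)%N => //=; apply: leq_trans IH (leq_pmull _ _).
Qed.

Lemma bin_mul_exp_le n t r : (t <= n)%N -> ('C(t, r) * n ^ r <= 'C(n, r) * t ^ r)%N.
Proof.
move=> tn; elim: r => [|r IH]; first by rewrite !bin0.
rewrite -(leq_pmul2l (ltn0Sn r)) !mulnA !mul_bin_left !expnS.
have e a b : ((a - r) * 'C(a, r) * (b * b ^ r) = ((a - r) * b) * ('C(a, r) * b ^ r))%N by ring.
by rewrite !e leq_mul //; nia.
Qed.

Lemma three_quarters_low r s : (4 * r <= 3 * s -> r + s %/ 4 <= s)%N.
Proof. lia. Qed.

Lemma three_quarters_high r s : (3 * s < 4 * r -> s + s %/ 4 <= 2 * r)%N.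
Proof. lia. Qed.

Section Estimates.
Variable R : realType.
Implicit Types (n k s t r m theta : nat) (c K eps : R).
Notation E := (expected R).

Lemma fkE n k : fk R n k = E n k.
Proof. by rewrite /fk /expected exprVn. Qed.

Lemma expected_ge0 n k : 0 <= E n k.
Proof. by rewrite mulr_ge0 ?exprn_ge0 ?invr_ge0. Qed.

Lemma expected_succ n k : (k <= n)%N ->
  E n k.+1 = E n k * ((n%:R - k%:R) / (k.+1%:R * 2 ^+ k)).
Proof.
move=> kn; rewrite /expected binS bin1 exprD.
have := congr1 (fun x : nat => x%:R : R) (mul_bin_left n k).
rewrite /= !natrM natrB // => h.
have -> : 'C(n, k.+1)%:R = (n%:R - k%:R) * 'C(n, k)%:R / k.+1%:R :> R.
  by rewrite -h mulrAC mulfV ?mul1r // pnatr_eq0.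
rewrite [2^-1 ^+ k]exprVn; field.
by rewrite expf_neq0 ?pnatr_eq0 //= -natr1 pnatr_eq0.
Qed.

(** The exponent s %/ 4 is the margin left on either side of the splitting
    point 3s/4 in [overlap_sum_small]. *)
Lemma exp_dominates M a : \forall s \near \oo, M * s%:R ^+ a <= 2 ^+ (s %/ 4) :> R.
Proof.
pose b := a.+1.
near=> s.
have s0 : (0 < s)%N by near: s; apply: nbhs_infty_gt.
have key : (s ^ b <= (4 * b) ^ b * 2 ^ (s %/ 4))%N.
  set m := (s %/ 4)%N; pose u := (m %/ b).+1.
  have mu : (m < b * u)%N by rewrite mulnC; apply: ltn_ceil.
  have su : (s <= 4 * b * u)%N by have := ltn_ceil s (isT : (0 < 4)%N); rewrite -/m; lia.
  apply: (@leq_trans ((4 * b * u) ^ b)); first by rewrite leq_exp2r.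
  rewrite expnMn leq_mul2l; apply/orP; right.
  apply: (@leq_trans ((2 ^ (m %/ b)) ^ b)); first by rewrite leq_exp2r // ltn_expl.
  by rewrite -expnM leq_exp2l // leq_trunc_div.
have Ms : M * (4 * b)%:R ^+ b <= s%:R.
  near: s; exact: nbhs_infty_ger.
have d0 : 0 < (4 * b)%:R ^+ b :> R by rewrite exprn_gt0 // ltr0n.
have key' : s%:R * s%:R ^+ a <= (4 * b)%:R ^+ b * 2 ^+ (s %/ 4) :> R.
  by rewrite -exprS -!natrX -natrM ler_nat.
rewrite -(ler_pM2l d0); apply: le_trans key'; rewrite mulrA ler_wpM2r ?exprn_ge0 //.
by rewrite mulrC.
Unshelve. all: by end_near. Qed.

Lemma exp_dominates2 M : \forall k \near \oo, M * k%:R ^+ 2 <= 2 ^+ k :> R.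
Proof.
apply: filterS (exp_dominates M 2) => k /le_trans -> //.
by rewrite ler_eXn2l ?leq_div ?ltr1n.
Qed.

Definition overlap_term n s t theta r : R :=
  'C(s, r)%:R * 'C(t, r)%:R / (E n r * theta%:R ^+ r).

Lemma overlap_term_ge0 n s t theta r : 0 <= overlap_term n s t theta r.
Proof. by rewrite divr_ge0 ?mulr_ge0 ?expected_ge0 ?exprn_ge0. Qed.

(** For small r: the term is at most (s t / n)^r 2^binom(r,2).  Its square is
    the r-th power of (s t / n)^2 2^(r-1), which avoids half-integral
    exponents. *)
Lemma overlap_term_small n s t theta r (eta : R) : (0 < theta)%N ->
  (2 <= r)%N -> (t <= n)%N -> (r <= n)%N -> (0 < n)%N -> 0 <= eta <= 1 ->
  (s * t)%:R ^+ 2 * 2 ^+ r <= eta * n%:R ^+ 2 ->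
  overlap_term n s t theta r <= eta.
Proof.
move=> th0 r2 tn rn n0 /andP[e0 e1] h.
have n0' : 0 < n%:R :> R by rewrite ltr0n.
have C0 : 0 < 'C(n, r)%:R :> R by rewrite ltr0n bin_gt0.
pose z : R := (s * t)%:R / n%:R.
have z0 : 0 <= z by rewrite divr_ge0.
have q_le : overlap_term n s t theta r <= z ^+ r * 2 ^+ 'C(r, 2).
  rewrite /overlap_term /expected.
  have th1 : 1 <= theta%:R ^+ r :> R by rewrite exprn_ege1 // ler1n.
  have cs : 'C(s, r)%:R <= s%:R ^+ r :> R by rewrite -natrX ler_nat leq_bin_exp.
  have ct : 'C(t, r)%:R / 'C(n, r)%:R <= (t%:R / n%:R) ^+ r :> R.
    rewrite expr_div_n ler_pdivrMr // mulrAC ler_pdivlMr ?exprn_gt0 //.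
    by rewrite -!natrX -!natrM ler_nat [(t ^ r * _)%N]mulnC bin_mul_exp_le.
  have -> : 'C(s, r)%:R * 'C(t, r)%:R / ('C(n, r)%:R * 2^-1 ^+ 'C(r, 2) * theta%:R ^+ r)
    = 'C(s, r)%:R * ('C(t, r)%:R / 'C(n, r)%:R) * 2 ^+ 'C(r, 2) / theta%:R ^+ r :> R.
    rewrite exprVn; set d := 2 ^+ _; set w := _ ^+ r.
    have d0 : d != 0 by rewrite expf_neq0 // pnatr_eq0.
    have w0 : w != 0 by rewrite expf_neq0 // pnatr_eq0 -lt0n.
    by field; rewrite d0 w0 gt_eqF.
  rewrite ler_pdivrMr ?(lt_le_trans _ th1) //.
  apply: (@le_trans _ _ (z ^+ r * 2 ^+ 'C(r, 2))); last first.
    by rewrite ler_peMr // mulr_ge0 ?exprn_ge0.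
  rewrite ler_wpM2r ?exprn_ge0 // /z natrM -mulrA exprMn.
  by apply: ler_pM => //; rewrite divr_ge0.
have z2 : z ^+ 2 * 2 ^+ r <= eta.
  by rewrite /z expr_div_n mulrAC ler_pdivrMr ?exprn_gt0.
have sq : (z ^+ r * 2 ^+ 'C(r, 2)) ^+ 2 <= eta ^+ 2.
  have sqE (x y : R) : (x ^+ r * y ^+ 'C(r, 2)) ^+ 2 = (x ^+ 2 * y ^+ r.-1) ^+ r.
    have e := mul_bin_left r 1; rewrite bin1 subn1 in e.
    rewrite !exprMn -!exprM [(r * 2)%N]mulnC [('C(r, 2) * 2)%N]mulnC e. by rewrite mul2n -addnn exprD.
  rewrite sqE.
  apply: (@le_trans _ _ (eta ^+ r)).
    rewrite lerXn2r ?nnegrE // ?mulr_ge0 ?exprn_ge0 //.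
    apply: le_trans z2; rewrite ler_wpM2l ?exprn_ge0 // ler_eXn2l ?leq_pred //.
    by rewrite ltr1n.
  by rewrite ler_wiXn2l.
apply: le_trans q_le _; rewrite -(@ler_pXn2r _ 2) // nnegrE.
by rewrite mulr_ge0 ?exprn_ge0.
Qed.


(** For large r: f(r+1)/f(r) is about n/(r 2^r), hence tiny, and this outweighs
    the decrease of the binomial coefficients. *)
Lemma overlap_term_step n s t theta r (rho : R) : (0 < theta <= 2)%N ->
  (r < s)%N -> (s <= t <= n)%N ->
  4 * s%:R * n%:R <= rho * 2 ^+ r ->
  overlap_term n s t theta r <= rho * overlap_term n s t theta r.+1.
Proof.
move=> /andP[th0 th2] rs /andP[st tn] h.
have rt : (r < t)%N by apply: leq_trans st.
have rn : (r < n)%N by apply: leq_trans tn.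
have step m : (r < m)%N -> 'C(m, r)%:R <= r.+1%:R * 'C(m, r.+1)%:R :> R.
  by move=> rm; rewrite -natrM ler_nat mul_bin_left leq_pmull // subn_gt0.
have cs := step s rs; have ct := step t rt.
have e := @expected_succ n r (ltnW rn).
have En : 0 < E n r by apply: expected_gt0; apply: ltnW.
have d0 : 0 < n%:R - r%:R :> R by rewrite subr_gt0 ltr_nat.
have dn : n%:R - r%:R <= n%:R :> R by rewrite gerDl oppr_le0.
have p2 : 0 < 2 ^+ r :> R by rewrite exprn_gt0.
have r1 : 0 < r.+1%:R :> R by rewrite ltr0n.
have th : 0 < theta%:R :> R by rewrite ltr0n.
have tr : 0 < theta%:R ^+ r :> R by rewrite exprn_gt0.
rewrite /overlap_term e exprS.
set A := 'C(s, r)%:R in cs *; set A' := 'C(s, r.+1)%:R in cs *.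
set B := 'C(t, r)%:R in ct *; set B' := 'C(t, r.+1)%:R in ct *.
have A0 : 0 <= A by rewrite ler0n.
have B0 : 0 <= B by rewrite ler0n.
have A'0 : 0 <= A' by rewrite ler0n.
have B'0 : 0 <= B' by rewrite ler0n.
set w := theta%:R ^+ r in tr *; set x := E n r in En *.
set d := n%:R - r%:R in d0 dn *; set p := 2 ^+ r in h p2 *.
have -> : rho * (A' * B' / (x * (d / (r.+1%:R * p)) * (theta%:R * w))) =
   (rho * p * r.+1%:R / (d * theta%:R)) * (A' * B') / (x * w).
  by field; rewrite !gt_eqF.
rewrite ler_pM2r; last by rewrite invr_gt0 mulr_gt0.
apply: (@le_trans _ _ ((r.+1%:R * A') * (r.+1%:R * B'))); first exact: ler_pM.
rewrite mulrACA ler_wpM2r ?mulr_ge0 //.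
rewrite [leRHS](_ : _ = r.+1%:R * (rho * p / (d * theta%:R))); last by rewrite mulrAC mulrC.
rewrite ler_pM2l //.
rewrite ler_pdivlMr ?mulr_gt0 //; apply: le_trans h.
have rs' : r.+1%:R <= s%:R :> R by rewrite ler_nat.
have th2' : theta%:R <= 2 :> R by rewrite ler_nat.
have s0 : 0 <= s%:R :> R by rewrite ler0n.
have n0 : 0 <= n%:R :> R by rewrite ler0n.
apply: (@le_trans _ _ (s%:R * (n%:R * 2))).
  apply: ler_pM => //; first by rewrite mulr_ge0 // ltW.
  by apply: ler_pM => //; exact: ltW.
have sn0 : 0 <= s%:R * n%:R :> R by apply: mulr_ge0.
lra.
Qed.

(** Below 3s/4 every term is at most eta; above, every term except the last
    is at most rho times the last one. *)
Lemma overlap_sum_le n s t theta (eta rho : R) : (0 < theta <= 2)%N ->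
  (s <= t <= n)%N -> (0 < n)%N -> 0 <= eta <= 1 -> 0 <= rho <= 1 ->
  (forall r, (4 * r <= 3 * s)%N -> (s * t)%:R ^+ 2 * 2 ^+ r <= eta * n%:R ^+ 2) ->
  (forall r, (3 * s < 4 * r)%N -> 4 * s%:R * n%:R <= rho * 2 ^+ r) ->
  overlap_sum R n s t theta <=
  (1 + s%:R * rho) * overlap_term n s t theta s + s%:R * eta.
Proof.
move=> th st n0 eta01 /andP[rho0 rho1] low high; have /andP[st' tn] := st.
have sn := leq_trans st' tn.
set q := overlap_term n s t theta.
have q0 r : 0 <= q r by exact: overlap_term_ge0.
have up r : (3 * s < 4 * r)%N -> (r <= s)%N -> q r <= q s /\ ((r < s)%N -> q r <= rho * q s).
  move=> hr rs; move: hr; rewrite -(subKn rs); move: (s - r)%N (leq_subr r s) => m.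
  elim: m => [|m IH] ms hr; first by rewrite subn0 ltnn.
  have msS : (s - m.+1).+1 = (s - m)%N by lia.
  have [IH1 _] := IH (ltnW ms) (ltac:(lia)).
  have st1 : q (s - m.+1)%N <= rho * q (s - m)%N.
    rewrite -msS; apply: overlap_term_step => //; first by lia.
    exact: high.
  have st2 : q (s - m.+1)%N <= rho * q s by apply: le_trans st1 _; rewrite ler_wpM2l.
  split=> //; apply: le_trans st2 _.
  by rewrite ler_piMl.
have bound r : (2 <= r < s)%N -> q r <= eta + rho * q s.
  move=> /andP[r2 rs]; have eta0 : 0 <= eta by case/andP: eta01.
  have rq : 0 <= rho * q s by rewrite mulr_ge0.
  have [hr|hr] := leqP (4 * r) (3 * s).
    apply: (@le_trans _ _ eta); last by rewrite lerDl.
    apply: overlap_term_small => //; [by case/andP: th|by apply: leq_trans (ltnW rs) sn|exact: low].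
  have [_ /(_ rs)] := up r hr (ltnW rs) => /le_trans -> //.
  by rewrite lerDr.
have [s1|s2] := ltnP s 2.
  rewrite /overlap_sum big_geq //; case/andP: eta01 => eta0 _.
  by apply: addr_ge0; apply: mulr_ge0 => //; rewrite addr_ge0 // mulr_ge0.
rewrite /overlap_sum big_nat_recr //= -/(overlap_term n s t theta s) -/q.
have : \sum_(2 <= r < s) 'C(s, r)%:R * 'C(t, r)%:R / (E n r * theta%:R ^+ r)
   <= \sum_(2 <= r < s) (eta + rho * q s).
  by apply: ler_sum_nat => r; apply: bound.
rewrite sumr_const_nat -[leRHS]mulr_natl.
have : (s - 2)%:R * (eta + rho * q s) <= s%:R * (eta + rho * q s).
  rewrite ler_wpM2r ?ler_nat ?leq_subr //; case/andP: eta01 => eta0 _.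
  by apply: addr_ge0 => //; apply: mulr_ge0.
lra.
Qed.

(** With n of order 2^(s/2), up to a factor s, both eta and rho of
    [overlap_sum_le] are exponentially small in s, so only the last term
    matters. *)
Lemma overlap_sum_small c K eps : 0 < c -> 0 < K -> 0 < eps ->
  \forall s \near \oo, forall n t theta, (0 < theta <= 2)%N ->
  (s <= t <= s + 2)%N -> (t <= n)%N ->
  c * 2 ^+ s <= n%:R ^+ 2 <= K * s%:R ^+ 2 * 2 ^+ s ->
  overlap_sum R n s t theta <=
  (1 + eps) * ('C(t, s)%:R / (E n s * theta%:R ^+ s)) + eps.
Proof.
move=> c0 K0 eps0; pose e := Num.min eps 1.
have e0 : 0 < e by rewrite lt_min eps0 ltr01.
have e1 : e <= 1 by rewrite ge_min lexx orbT.
have ee : e <= eps by rewrite ge_min lexx.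
near=> s.
have s2 : (2 <= s)%N by near: s; apply: nbhs_infty_ge.
have h1 : 16 / (e * c) * s%:R ^+ 5 <= 2 ^+ (s %/ 4) :> R by near: s; apply: exp_dominates.
have h2 : 16 * K / e ^+ 2 * s%:R ^+ 6 <= 2 ^+ (s %/ 4) :> R by near: s; apply: exp_dominates.
move=> n t theta th /andP[st ts] tn /andP[nc nK].
have s0 : 0 < s%:R :> R by rewrite ltr0n; apply: leq_trans s2.
have s1 : 1 <= s%:R :> R by rewrite ler1n; apply: leq_trans s2.
have sn := leq_trans st tn.
have n0 : (0 < n)%N by apply: leq_trans sn; apply: leq_trans s2.
have n0' : 0 < n%:R :> R by rewrite ltr0n.
have es : 0 <= e / s%:R <= 1.
  apply/andP; split; first by apply: divr_ge0; apply: ltW.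
  by rewrite ler_pdivrMr // mul1r (le_trans e1).
have -> : (1 + eps) * ('C(t, s)%:R / (E n s * theta%:R ^+ s)) + eps =
   (1 + eps) * overlap_term n s t theta s + eps.
  by rewrite /overlap_term binn mul1r.
apply: (@le_trans _ _ ((1 + s%:R * (e / s%:R)) * overlap_term n s t theta s + s%:R * (e / s%:R))).
  apply: overlap_sum_le => //; rewrite ?st //.
    move=> r r3.
    have esc0 : 0 <= e / s%:R * c by rewrite mulr_ge0 ?(ltW c0) //; case/andP: es.
    have st4 : (s * t)%:R ^+ 2 <= 16 * s%:R ^+ 4 :> R.
      rewrite -!natrX -natrM ler_nat.
      have t2 : (t <= 2 * s)%N by apply: leq_trans ts _; rewrite mul2n -addnn leq_add2l.
      apply: (@leq_trans ((s * (2 * s)) ^ 2)%N); first by rewrite leq_exp2r // leq_mul2l t2 orbT.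
      by rewrite (_ : ((s * (2 * s)) ^ 2 = 4 * s ^ 4)%N) ?leq_mul2r ?orbT //; ring.
    have rs : (r + s %/ 4 <= s)%N by exact: three_quarters_low.
    have p1 : 2 ^+ r * 2 ^+ (s %/ 4) <= 2 ^+ s :> R.
      by rewrite -exprD ler_eXn2l // ltr1n.
    apply: (@le_trans _ _ (e / s%:R * (c * 2 ^+ s))); last first.
      by rewrite ler_wpM2l //; case/andP: es.
    apply: (@le_trans _ _ (16 * s%:R ^+ 4 * 2 ^+ r)); first by rewrite ler_wpM2r ?exprn_ge0.
    apply: (@le_trans _ _ (e / s%:R * c * (2 ^+ r * 2 ^+ (s %/ 4)))); last first.
      by rewrite [leRHS]mulrA ler_wpM2l.
    rewrite [2 ^+ r * _]mulrC [leRHS]mulrA ler_wpM2r ?exprn_ge0 //.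
    apply: (@le_trans _ _ (e / s%:R * c * (16 / (e * c) * s%:R ^+ 5))); last first.
      by rewrite ler_wpM2l.
    by rewrite le_eqVlt; apply/orP; left; apply/eqP; field; rewrite !gt_eqF.
  move=> r r3.
  have rs : (s + s %/ 4 <= 2 * r)%N by exact: three_quarters_high.
  have p1 : 2 ^+ s * 2 ^+ (s %/ 4) <= (2 ^+ r) ^+ 2 :> R.
    by rewrite -exprD -exprM ler_eXn2l ?ltr1n // mulnC.
  have es0 : 0 <= e / s%:R by case/andP: es.
  rewrite -(@ler_pXn2r _ 2) ?nnegrE ?mulr_ge0 ?exprn_ge0 ?(ltW e0) ?invr_ge0 ?(ltW s0) ?(ltW n0') //.
  rewrite [leRHS]exprMn; apply: (@le_trans _ _ ((e / s%:R) ^+ 2 * (2 ^+ s * 2 ^+ (s %/ 4)))); last first.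
    by rewrite ler_wpM2l ?exprn_ge0.
  rewrite exprMn; apply: (@le_trans _ _ ((4 * s%:R) ^+ 2 * (K * s%:R ^+ 2 * 2 ^+ s))).
    by rewrite ler_wpM2l ?exprn_ge0 // mulr_ge0 // ltW.
  have := ler_wpM2l (_ : 0 <= (e / s%:R) ^+ 2 * 2 ^+ s) h2.
  rewrite mulr_ge0 ?exprn_ge0 // => /(_ isT); rewrite -[leRHS]mulrA; apply: le_trans.
  by rewrite le_eqVlt; apply/orP; left; apply/eqP; field; rewrite !gt_eqF.
have -> : s%:R * (e / s%:R) = e by field; rewrite gt_eqF.
have := overlap_term_ge0 n s t theta s; nra.
Unshelve. all: by end_near. Qed.

End Estimates.

(** * The size of n in terms of k when f(k) is of order 1 *)

Section Windows.
Variable R : realType.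
Implicit Types (n k s t r m theta : nat) (c K eps : R).
Notation E := (expected R).

(** The order of magnitude of n is k 2^(k/2); squares keep the exponents
    integral. *)
Definition window c K n k :=
  c * k%:R ^+ 2 * 2 ^+ k <= n%:R ^+ 2 <= K * k%:R ^+ 2 * 2 ^+ k.

Lemma expn_self_le k : k%:R ^+ k <= expR 1 ^+ k * k`!%:R :> R.
Proof.
have -> : expR 1 ^+ k = expR k%:R :> R by rewrite -expRM_natl mulr1.
case: k => [|k]; first by rewrite expR0 mul1r fact0.
have f0 : 0 < k.+1`!%:R :> R by rewrite ltr0n fact_gt0.
rewrite -ler_pdivrMr //; apply: le_trans (expR_ge1Dxn k (ler0n R k.+1)).
by rewrite lerDr.
Qed.

(** From binom(n,k) <= n^k/k! and k! >= (k/e)^k. *)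
Lemma expected_lower c n k : 0 < c <= 1 -> (0 < k)%N -> c <= E n k ->
  c ^+ 2 / (2 * expR 1 ^+ 2) * k%:R ^+ 2 * 2 ^+ k <= n%:R ^+ 2.
Proof.
move=> /andP[c0 c1] k0 cE.
have e0 : 0 < expR 1 :> R by exact: expR_gt0.
have p0 : 0 < 2 ^+ 'C(k, 2) :> R by rewrite exprn_gt0.
have f0 : 0 < k`!%:R :> R by rewrite ltr0n fact_gt0.
have h1 : c * 2 ^+ 'C(k, 2) * k`!%:R <= n%:R ^+ k.
  apply: (@le_trans _ _ ('C(n, k) * k`!)%:R).
    rewrite natrM ler_pM2r // -ler_pdivlMr //.
    by move: cE; rewrite /expected exprVn.
  rewrite -natrX ler_nat bin_ffact; elim: k {k0 cE p0 f0} => [|k IH]; first by rewrite ffactn0.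
  by rewrite ffactnSr expnSr leq_mul // leq_subr.
have h2 : c * 2 ^+ 'C(k, 2) * k%:R ^+ k <= expR 1 ^+ k * n%:R ^+ k.
  apply: (@le_trans _ _ (c * 2 ^+ 'C(k, 2) * (expR 1 ^+ k * k`!%:R))).
    by rewrite ler_wpM2l ?expn_self_le // mulr_ge0 // ltW.
  by rewrite mulrCA ler_wpM2l // exprn_ge0 // ltW.
have h3 : (c ^+ 2 * k%:R ^+ 2 * 2 ^+ k.-1) ^+ k <= (expR 1 ^+ 2 * n%:R ^+ 2) ^+ k.
  have sqE (x y z : R) : (x * y ^+ 'C(k, 2) * z ^+ k) ^+ 2 = x ^+ 2 * (z ^+ 2 * y ^+ k.-1) ^+ k.
    have e := mul_bin_left k 1; rewrite bin1 subn1 in e.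
    have ey : (y ^+ 'C(k, 2)) ^+ 2 = (y ^+ k.-1) ^+ k by rewrite -!exprM mulnC e.
    have ez : (z ^+ k) ^+ 2 = (z ^+ 2) ^+ k by rewrite -!exprM mulnC.
    by rewrite [(_ * y ^+ k.-1) ^+ k]exprMn -ey -ez; ring.
  apply: (@le_trans _ _ ((c * 2 ^+ 'C(k, 2) * k%:R ^+ k) ^+ 2)).
    rewrite sqE -[X in X ^+ k <= _]mulrA [leLHS]exprMn ler_wpM2r //.
    by apply: ler_iXnr => //; rewrite ?exprn_ge0 ?exprn_ile1 // ltW.
  rewrite (_ : (expR 1 ^+ 2 * n%:R ^+ 2) ^+ k = (expR 1 ^+ k * n%:R ^+ k) ^+ 2); last first.
    by rewrite -!exprMn -!exprM mulnC.
  by rewrite lerXn2r ?nnegrE ?mulr_ge0 ?exprn_ge0 // ltW.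
have h4 : c ^+ 2 * k%:R ^+ 2 * 2 ^+ k.-1 <= expR 1 ^+ 2 * n%:R ^+ 2.
  rewrite -(ler_pXn2r k0) ?nnegrE ?mulr_ge0 ?exprn_ge0 //; exact: ltW.
have e2 : 0 < expR 1 ^+ 2 :> R by rewrite exprn_gt0.
rewrite -(ler_pM2l e2); apply: le_trans h4.
have -> : 2 ^+ k = 2 * 2 ^+ k.-1 :> R by rewrite -exprS prednK.
by rewrite le_eqVlt; apply/orP; left; apply/eqP; field; rewrite gt_eqF.
Qed.

(** From binom(n,k) >= (n/k)^k. *)
Lemma expected_upper K n k : 1 <= K -> (0 < k)%N -> E n k <= K ->
  n%:R ^+ 2 <= K ^+ 2 * k%:R ^+ 2 * 2 ^+ k.-1.
Proof.
move=> K1 k0 EK; have K0 : 0 <= K by apply: le_trans K1.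
have p1 j : 1 <= 2 ^+ j :> R by rewrite exprn_ege1 // ler1n.
have K21 : 1 <= K ^+ 2 by rewrite exprn_ege1.
have [nk|kn] := ltnP n k.
  apply: (@le_trans _ _ (k%:R ^+ 2)).
    by rewrite lerXn2r ?nnegrE // ler_nat ltnW.
  rewrite mulrAC ler_peMl ?exprn_ge0 //.
  by rewrite mulr_ege1.
have p0 : 0 < 2 ^+ 'C(k, 2) :> R by rewrite exprn_gt0.
have h1 : n%:R ^+ k <= k%:R ^+ k * (K * 2 ^+ 'C(k, 2)).
  apply: (@le_trans _ _ (k%:R ^+ k * 'C(n, k)%:R)).
    have := bin_mul_exp_le k kn; rewrite binn mul1n -!natrX -natrM ler_nat => h.
    by rewrite [(k ^ k * _)%N]mulnC.
  rewrite ler_wpM2l ?exprn_ge0 // -ler_pdivrMr //.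
  by move: EK; rewrite /expected exprVn.
have h3 : (n%:R ^+ 2) ^+ k <= (K ^+ 2 * k%:R ^+ 2 * 2 ^+ k.-1) ^+ k.
  rewrite -exprM mulnC exprM; apply: (@le_trans _ _ ((k%:R ^+ k * (K * 2 ^+ 'C(k, 2))) ^+ 2)).
    by rewrite lerXn2r ?nnegrE ?mulr_ge0 ?exprn_ge0.
  have sqE (x y z : R) : (z ^+ k * (x * y ^+ 'C(k, 2))) ^+ 2 = x ^+ 2 * (z ^+ 2 * y ^+ k.-1) ^+ k.
    have e := mul_bin_left k 1; rewrite bin1 subn1 in e.
    have ey : (y ^+ 'C(k, 2)) ^+ 2 = (y ^+ k.-1) ^+ k by rewrite -!exprM mulnC e.
    have ez : (z ^+ k) ^+ 2 = (z ^+ 2) ^+ k by rewrite -!exprM mulnC.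
    by rewrite [(_ * y ^+ k.-1) ^+ k]exprMn -ey -ez; ring.
  rewrite sqE -[X in _ <= X ^+ k]mulrA [leRHS]exprMn ler_wpM2r //.
  exact: ler_eXnr.
by rewrite -(ler_pXn2r k0) ?nnegrE ?mulr_ge0 ?exprn_ge0.
Qed.

Lemma expected_plus2 n k : (k < n)%N ->
  E n (k + 2) * 2 ^+ (k + 2) =
  E n k * (2 * ((n%:R - k%:R) * (n%:R - k%:R - 1)) / (k.+1%:R * k.+2%:R * 2 ^+ k)).
Proof.
move=> kn; rewrite addn2 !expected_succ //; last exact: ltnW.
rewrite -[in n%:R - k.+1%:R]natr1 !exprS.
have p0 : 2 ^+ k != 0 :> R by rewrite expf_neq0 // pnatr_eq0.
have k1 : k.+1%:R != 0 :> R by rewrite pnatr_eq0.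
have k2 : k.+2%:R != 0 :> R by rewrite pnatr_eq0.
set a := k.+1%:R in k1 *; set b := k.+2%:R in k2 *; clearbody a b.
by field; rewrite p0 k1 k2.
Qed.

(** The reason for the shift by two: from k to k + 2 the value of f is
    multiplied by about (n/k)^2 2^(-2k-1), of order 2^(-k), and the 2^(k+2)
    colourings make up for this. *)
Lemma plus2_upper c K n k : window c K n k -> (0 < k)%N ->
  E n (k + 2) * 2 ^+ (k + 2) <= 2 * K * E n k.
Proof.
move=> /andP[_ nK] k0.
have k0' : 0 < k%:R :> R by rewrite ltr0n.
have p0 : 0 < 2 ^+ k :> R by rewrite exprn_gt0.
have d0 : 0 < k%:R ^+ 2 * 2 ^+ k :> R by rewrite mulr_gt0 ?exprn_gt0.
have K0 : 0 <= K.
  by rewrite -(pmulr_lge0 _ d0) mulrA; apply: le_trans nK; rewrite exprn_ge0.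
have [nk|kn] := leqP n k.
  rewrite {1}/expected bin_small ?addn2 ?ltnS ?(leq_trans nk) ?leqnSn // !mul0r.
  by rewrite !mulr_ge0 ?exprn_ge0 ?invr_ge0.
rewrite (expected_plus2 kn) mulrC ler_wpM2r ?expected_ge0 //.
rewrite ler_pdivrMr ?mulr_gt0 ?ltr0n // -[leRHS]mulrA ler_wpM2l //.
have kn' : k%:R + 1 <= n%:R :> R by rewrite natr1 ler_nat.
apply: (@le_trans _ _ (n%:R ^+ 2)).
  rewrite expr2; apply: ler_pM; lra.
apply: le_trans nK _; rewrite -mulrA ler_wpM2l // ler_wpM2r ?(ltW p0) //.
have k1 : k%:R <= k.+1%:R :> R by rewrite ler_nat.
have k2 : k%:R <= k.+2%:R :> R by rewrite ler_nat (leq_trans (leqnSn k)).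
by rewrite expr2; apply: ler_pM.
Qed.

Lemma plus2_lower c K n k : window c K n k -> (0 < k)%N -> (2 * k + 2 <= n)%N ->
  c / 12 * E n k <= E n (k + 2) * 2 ^+ (k + 2).
Proof.
move=> /andP[nc _] k0 kn.
have k0' : 1 <= k%:R :> R by rewrite ler1n.
have p0 : 0 < 2 ^+ k :> R by rewrite exprn_gt0.
rewrite expected_plus2; last by lia.
rewrite mulrC ler_wpM2l ?expected_ge0 // ler_pdivlMr ?mulr_gt0 ?ltr0n //.
have kn' : 2 * k%:R + 2 <= n%:R :> R by rewrite -natrM -natrD ler_nat.
rewrite -[k.+2%:R]natr1 -[k.+1%:R]natr1.
have h : (k%:R + 1) * (k%:R + 1 + 1) <= 6 * k%:R ^+ 2 :> R by nra.
have [c0|c0] := lerP 0 c; last first.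
  apply: (@le_trans _ _ 0); last by rewrite !mulr_ge0 //; lra.
  rewrite pmulr_lle0; first by lra.
  by rewrite !mulr_gt0 //; lra.
apply: (@le_trans _ _ (c / 12 * (6 * k%:R ^+ 2 * 2 ^+ k))).
  by rewrite ler_wpM2l ?divr_ge0 // ler_wpM2r // ltW.
nra.
Qed.

Lemma window_large c K : 0 < c ->
  \forall k \near \oo, forall n, window c K n k -> (2 * k + 2 <= n)%N.
Proof.
move=> c0; near=> k.
have k0 : (0 < k)%N by near: k; apply: nbhs_infty_gt.
have h : 16 / c * k%:R ^+ 0 <= 2 ^+ (k %/ 4) :> R by near: k; apply: exp_dominates.
move=> n /andP[nc _].
rewrite -(ler_nat R) -(@ler_pXn2r _ 2) ?nnegrE //; apply: le_trans nc.
have h2 : 16 <= c * 2 ^+ k.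
  rewrite -ler_pdivrMl // mulrC; apply: le_trans (_ : 2 ^+ (k %/ 4) <= _).
    by rewrite expr0 mulr1 in h.
  by rewrite ler_eXn2l ?leq_div ?ltr1n.
apply: (@le_trans _ _ ((4 * k)%:R ^+ 2)).
  by rewrite lerXn2r ?nnegrE // ler_nat; lia.
have k2 : 0 <= k%:R ^+ 2 :> R by rewrite exprn_ge0.
rewrite natrM exprMn [leRHS]mulrAC; apply: ler_wpM2r => //; lra.
Unshelve. all: by end_near. Qed.

(** Consecutive values of f are far apart, so at most one of them can be of
    order 1. *)
Lemma succ_small c K eps : 0 < K -> 0 < eps ->
  \forall k \near \oo, forall n, window c K n k -> E n k.+1 <= eps * E n k.
Proof.
move=> K0 eps0; near=> k.
have k0 : (0 < k)%N by near: k; apply: nbhs_infty_gt.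
have h : K / eps ^+ 2 * k%:R ^+ 0 <= 2 ^+ (k %/ 4) :> R by near: k; apply: exp_dominates.
move=> n /andP[_ nK].
have [nk|kn] := ltnP n k.
  rewrite {1}/expected bin_small ?(leq_trans nk) ?leqnSn // mul0r.
  by rewrite mulr_ge0 ?expected_ge0 // ltW.
rewrite expected_succ // mulrC ler_wpM2r ?expected_ge0 //.
have p0 : 0 < 2 ^+ k :> R by rewrite exprn_gt0.
have k0' : 0 < k%:R :> R by rewrite ltr0n.
rewrite ler_pdivrMr ?mulr_gt0 ?ltr0n //.
apply: (@le_trans _ _ n%:R); first by rewrite gerDl oppr_le0.
rewrite -(@ler_pXn2r _ 2) ?nnegrE ?mulr_ge0 ?(ltW eps0) ?(ltW p0) //.
apply: le_trans nK _; rewrite [leRHS]exprMn [(_ * 2 ^+ k) ^+ 2]exprMn.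
have h2 : K <= eps ^+ 2 * 2 ^+ k.
  rewrite -ler_pdivrMl ?exprn_gt0 // mulrC; apply: le_trans (_ : 2 ^+ (k %/ 4) <= _).
    by rewrite expr0 mulr1 in h.
  by rewrite ler_eXn2l ?leq_div ?ltr1n.
rewrite (_ : eps ^+ 2 * _ = (eps ^+ 2 * 2 ^+ k) * k.+1%:R ^+ 2 * 2 ^+ k); last by ring.
rewrite ler_wpM2r ?(ltW p0) //; apply: ler_pM => //; rewrite ?exprn_ge0 ?(ltW K0) //.
by rewrite lerXn2r ?nnegrE // ler_nat.
Unshelve. all: by end_near. Qed.

Lemma window_pred c K n k : 0 <= c -> 0 <= K -> (0 < k)%N ->
  window c K n k.+1 -> window c (8 * K) n k.
Proof.
move=> c0 K0 k0 /andP[lo up]; have p0 : 0 <= 2 ^+ k :> R by rewrite exprn_ge0.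
have k1 : 1 <= k%:R :> R by rewrite ler1n.
apply/andP; split.
  apply: le_trans lo; rewrite [2 ^+ k.+1]exprS; apply: ler_pM => //.
  - by rewrite mulr_ge0 ?exprn_ge0.
  - by rewrite ler_wpM2l // lerXn2r ?nnegrE // ler_nat.
  - lra.
apply: le_trans up _; rewrite [2 ^+ k.+1]exprS mulrA ler_wpM2r //.
have h : k.+1%:R ^+ 2 * 2 <= 8 * k%:R ^+ 2 :> R by rewrite -natr1; nra.
by have := ler_wpM2l K0 h; lra.
Qed.

(** The lower bound on n comes from the first inequality and the upper bound
    from the second. *)
Lemma window_of_crossing n k : (0 < k)%N -> 1 <= E n k -> E n k.+1 <= 1 ->
  window (2 * expR 1 ^+ 2)^-1 4 n k.
Proof.
move=> k0 e1 e2; apply/andP; split.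
  by have := @expected_lower 1 n k; rewrite ltr01 lexx expr1n mul1r; apply.
apply: le_trans (expected_upper (lexx 1) (ltn0Sn k) e2) _.
rewrite expr1n mul1r /= ler_wpM2r ?exprn_ge0 // -natr1.
have k1 : 1 <= k%:R :> R by rewrite ler1n.
nra.
Qed.

Lemma window_of_bounds a b : 0 < a -> 0 < b -> exists c K,
  [/\ 0 < c, 0 < K &
      forall n k, (0 < k)%N -> a <= E n k <= b -> window c K n k].
Proof.
move=> a0 b0; exists (Num.min a 1 ^+ 2 / (2 * expR 1 ^+ 2)), (Num.max b 1 ^+ 2).
have m0 : 0 < Num.min a 1 by rewrite lt_min a0 ltr01.
split.
- by rewrite divr_gt0 ?exprn_gt0 // mulr_gt0 // exprn_gt0 // expR_gt0.
- by rewrite exprn_gt0 // lt_max ltr01 orbT.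
move=> n k k0 /andP[aE Eb]; apply/andP; split.
  apply: expected_lower => //; last by rewrite ge_min aE.
  by rewrite m0 ge_min lexx orbT.
apply: le_trans (expected_upper (_ : 1 <= Num.max b 1) k0 _) _.
- by rewrite le_max lexx orbT.
- by rewrite le_max Eb.
by rewrite ler_wpM2l ?mulr_ge0 ?exprn_ge0 ?le_max ?ler01 ?orbT // ler_eXn2l ?leq_pred ?ltr1n.
Qed.

Lemma window_succ c K n k : 0 <= c -> 0 <= K -> (0 < k)%N ->
  window c K n k -> window (c / 8) K n k.+1.
Proof.
move=> c0 K0 k0 /andP[lo up].
have k1 : 1 <= k%:R :> R by rewrite ler1n.
have p0 : 0 <= 2 ^+ k :> R by rewrite exprn_ge0.
apply/andP; split.
  apply: le_trans lo; rewrite [2 ^+ k.+1]exprS mulrA ler_wpM2r //.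
  have h : k.+1%:R ^+ 2 * 2 <= 8 * k%:R ^+ 2 :> R by rewrite -natr1; nra.
  by have := ler_wpM2l c0 h; lra.
apply: le_trans up _; apply: ler_pM => //.
- by rewrite mulr_ge0 ?sqr_ge0.
- by rewrite ler_wpM2l // lerXn2r ?nnegrE // ler_nat.
- by rewrite ler_eXn2l ?ltr1n.
Qed.

(** A bounded k would bound n. *)
Lemma window_infty c K N : 0 < K ->
  \forall n \near \oo, forall k, window c K n k -> (N <= k)%N.
Proof.
move=> K0; near=> n => k /andP[_ up]; rewrite leqNgt; apply/negP => kN.
have big : K * N%:R ^+ 2 * 2 ^+ N < n%:R by near: n; apply: nbhs_infty_gtr.
have n1 : n%:R <= n%:R ^+ 2 :> R by rewrite -natrX ler_nat; case: (n) => // m; rewrite expnS leq_pmulr ?expn_gt0.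
have : K * k%:R ^+ 2 * 2 ^+ k <= K * N%:R ^+ 2 * 2 ^+ N.
  apply: ler_pM.
  - by rewrite mulr_ge0 ?sqr_ge0 // ltW.
  - by rewrite exprn_ge0.
  - by rewrite ler_pM2l // lerXn2r ?nnegrE // ler_nat ltnW.
  - by rewrite ler_eXn2l ?ltr1n // ltnW.
by apply/negP; rewrite -ltNge; apply: lt_le_trans big _; apply: le_trans n1 up.
Unshelve. all: by end_near. Qed.

End Windows.

(** * Hitting the families in G(n, 1/2) *)

Lemma bin2_le_sqr m k : (0 < k)%N -> (m <= k + 2)%N -> ('C(m, 2) <= 9 * k ^ 2)%N.
Proof.
move=> k0 mk; apply: leq_trans (leq_bin_exp _ _) _.
apply: (@leq_trans ((3 * k) ^ 2)%N); first by rewrite leq_exp2r //; lia.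
by rewrite expnMn.
Qed.

Lemma sqr_le_bin2 n : (2 <= n)%N -> (n ^ 2 <= 4 * 'C(n, 2))%N.
Proof.
move=> n2; have e := mul_bin_left n 1; rewrite bin1 in e.
rewrite -[4%N]/(2 * 2)%N -mulnA e expnS expn1; nia.
Qed.

Section Hits.
Variable R : realType.
Implicit Types (n k s t r m theta : nat) (a b c K eps delta : R).
Notation E := (expected R).

(** For p <= 1/4 one has 1/(1 - 2 p) <= 1 + 4 p <= exp(4 p). *)
Lemma expR_le_prod (I : finType) (F : {set I}) (p : I -> R) :
  (forall i, i \in F -> 0 <= p i <= 4^-1) ->
  expR (- (4 * \sum_(i in F) p i)) <= \prod_(i in F) (1 - 2 * p i).
Proof.
move=> h; rewrite mulr_sumr -sumrN expR_sum; apply: ler_prod => i iF.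
rewrite expR_ge0 /= expRN -[leRHS]invrK lef_pV2 ?posrE ?expR_gt0 //; last first.
  by rewrite invr_gt0; have := h i iF; lra.
have := h i iF => /andP[p0 p4]; apply: le_trans (expR_ge1Dx _).
have d0 : 0 < 1 - 2 * p i by lra.
by rewrite -[leLHS]mul1r ler_pdivrMr //; nra.
Qed.

Section Fixed.
Variable n : nat.
Notation P := (@Pr R (sgraph 'I_n)).
Notation bic := (@bicoloured 'I_n).
Notation meets := (@meet2 'I_n).
Notation wt := (weight R bic).
Notation ov := (overlap R bic meets).
Let O0 := card_sgraph_gt0 'I_n.

Definition hits F : pred (sgraph 'I_n) := occurs bic F.

(** The last term of the overlap sum is the inverse of the mean, since it stands
    for the pairs of equal vertex sets. *)
Lemma overlap_le_weight2 s theta F delta : (0 < theta)%N -> spread s theta F -> (s <= n)%N ->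
  E n s * theta%:R ^+ s / 2 <= wt F <= E n s * theta%:R ^+ s -> 0 <= delta <= 1 ->
  overlap_sum R n s s theta <= (1 + delta) / (E n s * theta%:R ^+ s) + delta ->
  ov F F <= wt F ^+ 2 * (8 / (E n s * theta%:R ^+ s) + 4 * delta).
Proof.
move=> th0 sp sn /andP[w1 w2] /andP[d0 d1] os.
set L := E n s * _ in w1 w2 os *.
have L0 : 0 < L by rewrite mulr_gt0 ?expected_gt0 // exprn_gt0 // ltr0n.
have w0 : 0 < wt F by apply: lt_le_trans w1; rewrite divr_gt0.
have := @overlap_spread R _ s s theta F F th0 sp (proj1 sp).
rewrite card_ord leqnn sn => /(_ isT) h; apply: le_trans h _.
rewrite expr2 -[leRHS]mulrA ler_pM2l // -/L.
have e1 : 2 * L * overlap_sum R n s s theta <= 4 + 2 * delta * L.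
  apply: (@le_trans _ _ (2 * L * ((1 + delta) / L + delta))).
    by rewrite ler_pM2l //; apply: mulr_gt0.
  rewrite [leLHS](_ : _ = 2 * (1 + delta) + 2 * delta * L); first by lra.
  by field; rewrite gt_eqF.
apply: le_trans e1 _.
have e2 : L / 2 * (8 / L + 4 * delta) = 4 + 2 * delta * L by field; rewrite gt_eqF.
by rewrite -e2 ler_wpM2r // addr_ge0 ?divr_ge0 ?mulr_ge0 // ltW.
Qed.

Lemma hits_ge F C : 0 < wt F -> ov F F <= wt F ^+ 2 * C -> (1 + C)^-1 <= P (hits F).
Proof.
move=> w0 ovC; have w2 : 0 < wt F ^+ 2 by rewrite exprn_gt0.
have o0 := overlap_ge0 R bic meets F F.
have C0 : 0 <= C by rewrite -(pmulr_rge0 _ w2) (le_trans o0).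
apply: le_trans (Pr_occurs_ge O0 (@bicoloured_indep R _) w0).
rewrite -[leLHS]mul1r ler_pdivrMr; last by lra.
rewrite mulrAC ler_pdivlMr; last by rewrite ltr_wpDr.
by rewrite mul1r mulrDr mulr1 lerD2l.
Qed.

(** A random t-set contains a given pair with probability of order (t/n)^2, and
    n^2 is exponentially large in k. *)
Lemma dependent_weight_small t theta (F : {set {set 'I_n} * {set 'I_n}}) (i : {set 'I_n} * {set 'I_n}) c K eps k : (0 < theta)%N -> spread t theta F -> (2 <= t <= n)%N ->
  window c K n k -> 0 < c -> (0 < k)%N -> (t <= k + 2)%N -> (#|i.1| <= k + 2)%N ->
  36 ^+ 2 / c * k%:R ^+ 2 <= eps * 2 ^+ k ->
  \sum_(j in F | meets i j) P (bic j) <= eps * (E n t * theta%:R ^+ t).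
Proof.
move=> th0 sp t2 /andP[nc _] c0 k0 tk ik h.
have /andP[t2' tn] := t2.
have := @dependent_weight_le R _ t theta F i th0 sp; rewrite card_ord => /(_ t2) h1.
apply: le_trans h1 _; set L := E n t * _.
have L0 : 0 <= L by rewrite mulr_ge0 ?expected_ge0 ?exprn_ge0.
have n2 : (2 <= n)%N by apply: leq_trans tn.
have C0 : 0 < 'C(n, 2)%:R :> R by rewrite ltr0n bin_gt0.
have k0' : 1 <= k%:R :> R by rewrite ler1n.
have bnd m : (m <= k + 2)%N -> 'C(m, 2)%:R <= 9 * k%:R ^+ 2 :> R.
  by move=> mk; rewrite -natrX -natrM ler_nat bin2_le_sqr.
have Cn : n%:R ^+ 2 <= 4 * 'C(n, 2)%:R :> R.
  by rewrite -natrX -natrM ler_nat sqr_le_bin2.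
rewrite -mulrA mulrCA [leRHS]mulrC ler_wpM2l //.
have p2 : 0 < 2 ^+ k :> R by rewrite exprn_gt0.
apply: (@le_trans _ _ (4 * ((9 * k%:R ^+ 2) * (9 * k%:R ^+ 2) / 'C(n, 2)%:R))).
  rewrite ler_pM2l // ler_pM2r ?invr_gt0 //; apply: ler_pM => //; exact: bnd.
rewrite mulrA ler_pdivrMr //.
have e1 : eps * (c * k%:R ^+ 2 * 2 ^+ k) <= eps * (4 * 'C(n, 2)%:R).
  rewrite ler_wpM2l //; last by apply: le_trans Cn.
  rewrite -(pmulr_lge0 _ p2); apply: le_trans h.
  by apply: mulr_ge0; [apply: divr_ge0; [exact: sqr_ge0|exact: ltW]|exact: sqr_ge0].
have e2 : 36 ^+ 2 * k%:R ^+ 2 <= c * (eps * 2 ^+ k).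
  by rewrite -ler_pdivrMl // mulrA [c^-1 * _]mulrC.
have k2 : 0 <= k%:R ^+ 2 :> R by rewrite exprn_ge0.
have := ler_wpM2r k2 e2; lra.
Qed.


(** The shape of the bounds given by [second_moment], for a mean w and an overlap
    o that is at most C w^2. *)
Lemma ratio_ge (w o C x y : R) : 0 < w -> 0 <= o -> o <= w ^+ 2 * C -> 0 <= x -> w * x <= y ->
  x ^+ 2 / (1 + C) <= y ^+ 2 / (w ^+ 2 + o).
Proof.
move=> w0 o0 oC x0 xy; have w2 : 0 < w ^+ 2 by rewrite exprn_gt0.
have C0 : 0 <= C by rewrite -(pmulr_rge0 _ w2) (le_trans o0).
rewrite ler_pdivrMr; last by lra.
rewrite mulrAC ler_pdivlMr; last by rewrite ltr_wpDr.
have y2 : w ^+ 2 * x ^+ 2 <= y ^+ 2.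
  rewrite -exprMn lerXn2r ?nnegrE ?mulr_ge0 ?(ltW w0) //.
  by apply: le_trans xy; rewrite mulr_ge0 // ltW.
apply: (@le_trans _ _ (x ^+ 2 * (w ^+ 2 + w ^+ 2 * C))).
  by rewrite ler_wpM2l ?sqr_ge0 // lerD2l.
have -> : x ^+ 2 * (w ^+ 2 + w ^+ 2 * C) = w ^+ 2 * x ^+ 2 * (1 + C) by ring.
by rewrite ler_wpM2r //; lra.
Qed.

(** Once the overlaps are under control, p bounds from below the probability of
    avoiding everything, by the local lemma, and q that of hitting a given family,
    by the second moment; each mixed pattern loses at most half of p or q. *)
Lemma four_hit_patterns (F J : {set {set 'I_n} * {set 'I_n}}) a b C (eta : R) :
  let p := expR (- (8 * b)) in let q := (1 + C)^-1 in
  0 < a -> a <= wt F <= b -> a <= wt J <= b ->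
  ov F F <= wt F ^+ 2 * C -> ov J J <= wt J ^+ 2 * C ->
  ov F J <= a * (p / 2) ->
  (forall i, i \in F -> \sum_(j in F | meets i j) P (bic j) <= eta) ->
  (forall i, i \in F -> \sum_(j in J | meets i j) P (bic j) <= eta) ->
  (forall i, i \in J -> \sum_(j in F | meets i j) P (bic j) <= eta) ->
  (forall i, i \in J -> \sum_(j in J | meets i j) P (bic j) <= eta) ->
  (forall i, i \in F :|: J -> meets i i) ->
  eta <= 8^-1 -> eta <= q / 2 ->
  [/\ (q / 2) ^+ 2 / (1 + C) <= P (fun G => hits F G && hits J G),
      (p / 2) ^+ 2 / (1 + C) <= P (fun G => hits F G && ~~ hits J G),
      (p / 2) ^+ 2 / (1 + C) <= P (fun G => ~~ hits F G && hits J G) &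
      p <= P (fun G => ~~ hits F G && ~~ hits J G)].
Proof.
move=> p q a0 /andP[aF Fb] /andP[aJ Jb] ovF ovJ ovFJ FF FJ JF JJ refl eta8 etaq.
have wF0 : 0 < wt F by apply: lt_le_trans aF.
have wJ0 : 0 < wt J by apply: lt_le_trans aJ.
have p0 : 0 < p by exact: expR_gt0.
have w2 : 0 < wt F ^+ 2 by rewrite exprn_gt0.
have oF0 := overlap_ge0 R bic meets F F.
have oJ0 := overlap_ge0 R bic meets J J.
have C0 : 0 <= C by rewrite -(pmulr_rge0 _ w2) (le_trans oF0).
have q0 : 0 < q by rewrite invr_gt0; lra.
pose indep := @bicoloured_indep R 'I_n.
have locU i : i \in F :|: J -> \sum_(j in F :|: J | meets i j) P (bic j) <= 4^-1.
  move=> iU.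
  apply: (@le_trans _ _ (\sum_(j in F | meets i j) P (bic j) +
      \sum_(j in J | meets i j) P (bic j))).
    rewrite big_mkcond [X in _ <= X + _]big_mkcond [X in _ <= _ + X]big_mkcond.
    rewrite -big_split /=; apply: ler_sum => j _; rewrite inE.
    have pj : 0 <= P (bic j) by apply: Pr_ge0.
    case: (j \in F); case: (j \in J); case: (meets i j); rewrite /= ?addr0 ?add0r //.
    by rewrite lerDl.
  move: iU; rewrite inE => /orP[] iF.
    by have := FF i iF; have := FJ i iF; lra.
  by have := JF i iF; have := JJ i iF; lra.
have refl' : {in F :|: J, forall i, meets i i} by [].
have pU : p <= P (avoids bic (F :|: J)).
  apply: le_trans (local_lemma O0 indep refl' locU).
  apply: le_trans (expR_le_prod (F := F :|: J) (p := fun i => P (bic i)) _).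
    rewrite ler_expR lerN2.
    have : \sum_(i in F :|: J) P (bic i) <= wt F + wt J.
      rewrite /weight big_mkcond [X in _ <= X + _]big_mkcond [X in _ <= _ + X]big_mkcond.
      rewrite -big_split /=; apply: ler_sum => j _; rewrite inE.
      have pj : 0 <= P (bic j) by apply: Pr_ge0.
      case: (j \in F); case: (j \in J); rewrite /= ?addr0 ?add0r //.
      by rewrite lerDl.
    lra.
  move=> i iU; rewrite Pr_ge0 //=; apply: le_trans (locU i iU).
  rewrite (bigD1 i) ?iU ?refl //= lerDl; apply: sumr_ge0 => j _; exact: Pr_ge0.
have pF : p <= P (avoids bic F).
  by apply: le_trans pU _; apply: (Pr_le R O0) => G; apply/avoids_le/finset.subsetUl.
have pJ : p <= P (avoids bic J).
  by apply: le_trans pU _; apply: (Pr_le R O0) => G; apply/avoids_le/finset.subsetUr.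
have ovJF : ov J F <= a * (p / 2) by rewrite overlapC.
have xJ : wt J * (p / 2) <= wt J * P (avoids bic F) - ov J F.
  have := ler_wpM2l (ltW wJ0) pF; have : a * (p / 2) <= wt J * (p / 2).
    by rewrite ler_wpM2r // divr_ge0 // ltW.
  lra.
have xF : wt F * (p / 2) <= wt F * P (avoids bic J) - ov F J.
  have := ler_wpM2l (ltW wF0) pJ; have : a * (p / 2) <= wt F * (p / 2).
    by rewrite ler_wpM2r // divr_ge0 // ltW.
  lra.
have p20 : 0 <= p / 2 by rewrite divr_ge0 // ltW.
have hN Z : hits Z =1 (fun G => ~~ avoids bic Z G) by move=> G; apply: occursN.
split.
- have qJ : q <= P (hits J) by exact: hits_ge.
  apply: le_trans (occurs_and_occurs O0 indep wF0 FJ _); last first.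
    by apply: le_trans etaq _; apply: le_trans qJ; lra.
  apply: ratio_ge => //; first by rewrite divr_ge0 // ltW.
  by rewrite ler_pM2l // -/(hits J); lra.
- apply: le_trans (_ : P (fun G => occurs bic F G && avoids bic J G) <= _).
    apply: le_trans (occurs_and_avoids O0 indep wF0 _); first exact: ratio_ge.
    by rewrite -subr_ge0; apply: le_trans xF; apply: mulr_ge0 => //; exact: ltW.
  by apply: (Pr_le R O0) => G /andP[h1 h2]; rewrite (hN J) negbK h2 andbT.
- apply: le_trans (_ : P (fun G => occurs bic J G && avoids bic F G) <= _).
    apply: le_trans (occurs_and_avoids O0 indep wJ0 _); first exact: ratio_ge.
    by rewrite -subr_ge0; apply: le_trans xJ; apply: mulr_ge0 => //; exact: ltW.
  by apply: (Pr_le R O0) => G /andP[h1 h2]; rewrite (hN F) negbK h2.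
apply: le_trans pU _; apply: (Pr_le R O0) => G h; rewrite !hN !negbK.
by rewrite !(avoids_le _ h) ?finset.subsetUl ?finset.subsetUr.
Qed.


End Fixed.
End Hits.

(** * Asymptotics in k *)

Lemma near_infty_add (Q : nat -> Prop) d :
  (\forall k \near \oo, Q k) -> \forall k \near \oo, Q (k + d)%N.
Proof. by case=> N _ hN; exists N => // k /= Nk; apply: hN; apply: leq_trans Nk (leq_addr _ _). Qed.

Section Asymptotics.
Variable R : realType.
Implicit Types (n k s t r m theta : nat) (a b c K eps delta : R).
Notation E := (expected R).
Notation P n := (@Pr R (sgraph 'I_n)).
Notation wt n := (weight R (@bicoloured 'I_n)).
Notation ov n := (overlap R (@bicoloured 'I_n) (@meet2 'I_n)).
Notation indep_sets n k := (independent_family 'I_n k).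
Notation bicliques n m := (biclique_family 'I_n m).

Lemma overlap_sums_near c K eps : 0 < c -> 0 < K -> 0 < eps ->
  \forall k \near \oo, forall n, window c K n k ->
  [/\ overlap_sum R n k k 1 <= (1 + eps) / (E n k * 1 ^+ k) + eps,
      overlap_sum R n (k + 2) (k + 2) 2 <= (1 + eps) / (E n (k + 2) * 2 ^+ (k + 2)) + eps &
      overlap_sum R n k (k + 2) 2 <= (1 + eps) * ('C(k + 2, k)%:R / (E n k * 2 ^+ k)) + eps].
Proof.
move=> c0 K0 eps0; have c40 : 0 < c / 4 by rewrite divr_gt0.
have small := overlap_sum_small c40 K0 eps0.
have small2 := near_infty_add 2 small.
apply: filter_app small; apply: filter_app small2; apply: filter_app (@window_large R c K c0).
near=> k => large small2 small n w.
have k0 : (0 < k)%N by near: k; apply: nbhs_infty_gt.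
have kn : (2 * k + 2 <= n)%N by exact: large w.
have kn2 : (k + 2 <= n)%N by apply: leq_trans kn; rewrite leq_add2r leq_pmull.
have kn0 : (k <= n)%N by apply: leq_trans kn2; apply: leq_addr.
have k1 : 1 <= k%:R ^+ 2 :> R by rewrite exprn_ege1 // ler1n.
have p0 : 0 < 2 ^+ k :> R by rewrite exprn_gt0.
have /andP[lo up] := w.
have lo' : c * 2 ^+ k <= n%:R ^+ 2.
  by apply: le_trans lo; rewrite ler_wpM2r ?(ltW p0) // ler_peMr // ltW.
have w1 : c / 4 * 2 ^+ k <= n%:R ^+ 2 <= K * k%:R ^+ 2 * 2 ^+ k.
  rewrite up andbT; apply: le_trans lo'; rewrite ler_wpM2r ?(ltW p0) //; lra.
have w2 : c / 4 * 2 ^+ (k + 2) <= n%:R ^+ 2 <= K * (k + 2)%:R ^+ 2 * 2 ^+ (k + 2).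
  apply/andP; split.
    apply: le_trans lo'; rewrite le_eqVlt; apply/orP; left; apply/eqP.
    by rewrite exprD; field.
  apply: le_trans up _; apply: ler_pM.
  - by rewrite mulr_ge0 ?exprn_ge0 // ltW.
  - exact: ltW.
  - by rewrite ler_wpM2l ?(ltW K0) // lerXn2r ?nnegrE // ler_nat leq_addr.
  - by rewrite ler_eXn2l ?leq_addr ?ltr1n.
split.
- have := small n k 1%N; rewrite binn div1r; apply=> //.
  by rewrite leqnn leq_addr.
- have := small2 n (k + 2)%N 2%N; rewrite binn div1r; apply=> //.
  by rewrite leqnn leq_addr.
- apply: small => //; by rewrite leqnn leq_addr.
Unshelve. all: by end_near. Qed.

Lemma weights n k : (0 < k)%N ->
  wt n (indep_sets n k) = E n k /\
  E n (k + 2) * 2 ^+ (k + 2) / 2 <= wt n (bicliques n (k + 2)) <= E n (k + 2) * 2 ^+ (k + 2).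
Proof.
move=> k0; split; first by rewrite weight_independent_family card_ord.
have := @weight_biclique_family R 'I_n (k + 2); rewrite card_ord; apply.
by rewrite addn2.
Qed.

Lemma family_overlaps_near c K delta : 0 < c -> 0 < K -> 0 < delta <= 1 ->
  \forall k \near \oo, forall n, window c K n k ->
  ov n (indep_sets n k) (indep_sets n k) <=
    wt n (indep_sets n k) ^+ 2 * (8 / E n k + 4 * delta) /\
  ov n (bicliques n (k + 2)) (bicliques n (k + 2)) <=
    wt n (bicliques n (k + 2)) ^+ 2 * (8 / (E n (k + 2) * 2 ^+ (k + 2)) + 4 * delta).
Proof.
move=> c0 K0 /andP[d0 d1].
apply: filter_app (overlap_sums_near c0 K0 d0); apply: filter_app (@window_large R c K c0).
near=> k => large sums n w.
have k0 : (0 < k)%N by near: k; apply: nbhs_infty_gt.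
have kn : (2 * k + 2 <= n)%N by exact: large w.
have kn2 : (k + 2 <= n)%N by apply: leq_trans kn; rewrite leq_add2r leq_pmull.
have kn0 : (k <= n)%N by apply: leq_trans kn2; apply: leq_addr.
have [sum1 sum2 _] := sums n w.
have [wX wY] := weights n k0.
have dd : 0 <= delta <= 1 by rewrite (ltW d0).
split.
  have := @overlap_le_weight2 R n k 1 _ delta (leqnn _) (independent_family_spread _ k) kn0.
  rewrite wX !expr1n !mulr1; apply=> //; last by move: sum1; rewrite expr1n mulr1.
  have E0 : 0 <= E n k by exact: expected_ge0.
  by rewrite lexx andbT ler_pdivrMr //; lra.
by apply: (@overlap_le_weight2 R n (k + 2) 2 _ delta) => //; apply: biclique_family_spread.
Unshelve. all: by end_near. Qed.

(** By the second moment, as the means are at least of order M. *)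
Lemma hits_near_one c K eps : 0 < c -> 0 < K -> 0 < eps ->
  exists2 M, 0 < M & \forall k \near \oo, forall n, window c K n k -> M <= E n k ->
  1 - eps <= P n (hits (indep_sets n k)) /\ 1 - eps <= P n (hits (bicliques n (k + 2))).
Proof.
move=> c0 K0 eps0; pose delta := Num.min (eps / 8) 1.
have dd : 0 < delta <= 1 by rewrite lt_min ge_min lexx ltr01 orbT divr_gt0.
have d8 : 4 * delta <= eps / 2.
  have h : delta <= eps / 8 by rewrite ge_min lexx.
  lra.
exists (16 / eps + 192 / (c * eps)).
  by rewrite addr_gt0 // divr_gt0 // mulr_gt0.
apply: filter_app (family_overlaps_near c0 K0 dd); apply: filter_app (@window_large R c K c0).
near=> k => large fo n w ME.
have k0 : (0 < k)%N by near: k; apply: nbhs_infty_gt.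
have kn : (2 * k + 2 <= n)%N by exact: large w.
have [wX /andP[wY _]] := weights n k0.
have [ov1 ov2] := fo n w.
have inv C : 0 <= C <= eps -> 1 - eps <= (1 + C)^-1.
  move=> /andP[C0 Ce]; rewrite -[leRHS]mul1r ler_pdivlMr; last by lra.
  by nra.
have u0 : 0 < 16 / eps by rewrite divr_gt0.
have v0 : 0 < 192 / (c * eps) by rewrite divr_gt0 // mulr_gt0.
have d0 : 0 < delta by case/andP: dd.
have small L : 16 / eps <= L -> 0 <= 8 / L + 4 * delta <= eps.
  move=> hL; have L0 : 0 < L by apply: lt_le_trans hL.
  have : 8 / L <= eps / 2.
    by rewrite ler_pdivrMr // mulrAC ler_pdivlMr // -ler_pdivrMl // mulrC; lra.
  have : 0 < 8 / L by rewrite divr_gt0.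
  by move=> ? ?; apply/andP; split; lra.
have E16 : 16 / eps <= E n k by lra.
have L16 : 16 / eps <= E n (k + 2) * 2 ^+ (k + 2).
  apply: le_trans (plus2_lower w k0 kn).
  apply: (@le_trans _ _ (c / 12 * (192 / (c * eps)))).
    by rewrite le_eqVlt; apply/orP; left; apply/eqP; field; rewrite !gt_eqF.
  by rewrite ler_wpM2l ?divr_ge0 ?(ltW c0) //; lra.
split; apply: le_trans (hits_ge _ _).
- exact: inv (small _ E16).
- by rewrite wX; lra.
- exact: ov1.
- exact: inv (small _ L16).
- by apply: lt_le_trans wY; lra.
- exact: ov2.
Unshelve. all: by end_near. Qed.

Lemma hits_le n k : (0 < k)%N -> P n (hits (indep_sets n k)) <= E n k /\
  P n (hits (bicliques n (k + 2))) <= E n (k + 2) * 2 ^+ (k + 2).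
Proof.
move=> k0; have [wX /andP[_ wY]] := weights n k0; split.
  by rewrite -wX; apply: Pr_occurs_le; apply: card_sgraph_gt0.
by apply: le_trans wY; apply: Pr_occurs_le; apply: card_sgraph_gt0.
Qed.


(** For f(k) of order 1 the means are of order 1 and the mixed and local overlaps
    tend to 0, so [four_hit_patterns] applies with constants that do not depend
    on k. *)
Lemma four_hit_patterns_likely a b : 0 < a -> 0 < b ->
  exists2 delta, 0 < delta & \forall k \near \oo, forall n, a <= E n k <= b ->
  let X := hits (indep_sets n k) in let Y := hits (bicliques n (k + 2)) in
  [/\ delta <= P n (fun G => X G && Y G), delta <= P n (fun G => X G && ~~ Y G),
      delta <= P n (fun G => ~~ X G && Y G) & delta <= P n (fun G => ~~ X G && ~~ Y G)].
Proof.
move=> a0 b0.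
have [c [K [c0 K0 win]]] := window_of_bounds a0 b0.
(* A and B are common bounds, from below and above, for the means of both
   families, C bounds both relative overlaps, and h is the size that the mixed
   overlap sum must not exceed. *)
pose A : R := Num.min a (c / 24 * a); pose B : R := Num.max b (2 * K * b).
have A0 : 0 < A by rewrite lt_min a0 mulr_gt0 // divr_gt0.
have B0 : 0 < B by rewrite lt_max b0.
have Aa : A <= a by rewrite ge_min lexx.
have Ac : A <= c / 24 * a by rewrite ge_min lexx orbT.
have bB : b <= B by rewrite le_max lexx.
have KB : 2 * K * b <= B by rewrite le_max lexx orbT.
clearbody A B.
pose C : R := 8 / A + 4; have C0 : 0 < C by rewrite addr_gt0 // divr_gt0.
pose p : R := expR (- (8 * B)); have p0 : 0 < p by exact: expR_gt0.
pose q : R := (1 + C)^-1; have q0 : 0 < q by rewrite invr_gt0; lra.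
pose h : R := A * p / (4 * B ^+ 2); have h0 : 0 < h by rewrite divr_gt0 ?mulr_gt0 // exprn_gt0.
pose e : R := Num.min 1 (h / 2).
have e0 : 0 < e by rewrite lt_min ltr01 divr_gt0.
have e1 : e <= 1 by rewrite ge_min lexx.
have eh : e <= h / 2 by rewrite ge_min lexx orbT.
pose eta : R := Num.min 8^-1 (q / 2).
have eta0 : 0 < eta by rewrite lt_min invr_gt0 divr_gt0 // ltr0n.
have eta8 : eta <= 8^-1 by rewrite ge_min lexx.
have etaq : eta <= q / 2 by rewrite ge_min lexx orbT.
pose l : R := eta / B; have l0 : 0 < l by rewrite divr_gt0.
exists (Num.min ((q / 2) ^+ 2 / (1 + C)) (Num.min ((p / 2) ^+ 2 / (1 + C)) p)).
  have C1 : 0 < 1 + C by lra.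
  by rewrite !lt_min p0 !divr_gt0 // exprn_gt0 // divr_gt0.
have hE : B * (2 * B * h) = A * (p / 2) by rewrite /h; field; rewrite gt_eqF.
have lE : l * B = eta by rewrite /l divfK // gt_eqF.
have h40 : 0 <= h / 4 by apply: divr_ge0 => //; apply: ltW.
clearbody e eta h l.
have d11 : 0 < (1 : R) <= 1 by rewrite ltr01 lexx.
apply: filter_app (family_overlaps_near c0 K0 d11); apply: filter_app (@window_large R c K c0).
apply: filter_app (overlap_sums_near c0 K0 e0).
near=> k => sums large fo n ab.
have k2 : (2 <= k)%N by near: k; apply: nbhs_infty_ge.
have k0 : (0 < k)%N by apply: leq_trans k2.
have h1 : 36 / (a * h) * k%:R ^+ 2 <= 2 ^+ k by near: k; apply: exp_dominates2.
have h2 : 36 ^+ 2 / (c * l) * k%:R ^+ 2 <= 2 ^+ k by near: k; apply: exp_dominates2.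
have w := win n k k0 ab.
have kn := large n w.
have kn2 : (k + 2 <= n)%N by apply: leq_trans kn; rewrite leq_add2r leq_pmull.
have kn0 : (k <= n)%N by apply: leq_trans kn2; apply: leq_addr.
have [_ _ os3] := sums n w; have [ov1 ov2] := fo n w; have [wX wY] := weights n k0.
have /andP[aE Eb] := ab.
have Lu := plus2_upper w k0; have Ll := plus2_lower w k0 kn.
have [spX spY] := (independent_family_spread 'I_n k, biclique_family_spread 'I_n (k + 2)).
set L := E n (k + 2) * 2 ^+ (k + 2) in wY Lu Ll ov2.
have AL : 2 * A <= L.
  have c24 : 0 <= c / 24 by apply: divr_ge0 => //; apply: ltW.
  apply: le_trans Ll; have := ler_wpM2l c24 aE; lra.
have LB : L <= B.
  by apply: le_trans Lu _; apply: le_trans KB; rewrite ler_pM2l // mulr_gt0.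
have L0 : 0 < L by lra.
have /andP[wY1 wY2] := wY.
have wA : A <= wt n (bicliques n (k + 2)) <= B.
  by rewrite (le_trans wY2 LB) andbT; apply: le_trans wY1; rewrite ler_pdivlMr // mulrC.
have wA' : A <= wt n (indep_sets n k) <= B.
  by rewrite wX (le_trans Aa aE) (le_trans Eb bB).
have inv8 x : A <= x -> 8 / x + 4 * 1 <= C.
  move=> Ax; rewrite mulr1 lerD2r ler_pM2l // lef_pV2 ?posrE //; exact: lt_le_trans Ax.
have ovX : ov n (indep_sets n k) (indep_sets n k) <= wt n (indep_sets n k) ^+ 2 * C.
  apply: le_trans ov1 _; rewrite ler_wpM2l ?sqr_ge0 //; apply: inv8; exact: le_trans aE.
have ovY : ov n (bicliques n (k + 2)) (bicliques n (k + 2)) <= wt n (bicliques n (k + 2)) ^+ 2 * C.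
  apply: le_trans ov2 _; rewrite ler_wpM2l ?sqr_ge0 //; apply: inv8; clear -A0 AL; lra.
have p2 : 0 < 2 ^+ k :> R by rewrite exprn_gt0.
have osh : overlap_sum R n k (k + 2) 2 <= h.
  apply: le_trans os3 _.
  have Ck : 'C(k + 2, k)%:R <= 9 * k%:R ^+ 2 :> R.
    rewrite -natrX -natrM ler_nat -bin_sub ?leq_addr // [(k + 2 - k)%N]addKn.
    exact: bin2_le_sqr.
  have E0 : 0 < E n k by apply: lt_le_trans aE.
  have t4 : 'C(k + 2, k)%:R / (E n k * 2 ^+ k) <= h / 4.
    rewrite ler_pdivrMr; last by apply: mulr_gt0.
    apply: le_trans Ck _.
    apply: (@le_trans _ _ (h / 4 * (a * 2 ^+ k))); last first.
      by apply: ler_wpM2l => //; apply: ler_wpM2r => //; apply: ltW.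
    apply: (@le_trans _ _ (h / 4 * (a * (36 / (a * h) * k%:R ^+ 2)))); last first.
      by apply: ler_wpM2l => //; apply: ler_wpM2l => //; apply: ltW.
    by rewrite le_eqVlt; apply/orP; left; apply/eqP; field; rewrite !gt_eqF.
  have t0 : 0 <= 'C(k + 2, k)%:R / (E n k * 2 ^+ k) by apply: divr_ge0 => //; apply: mulr_ge0; apply: ltW.
  move: t4 t0; set x := _ / _ => t4 t0; clear -t4 t0 e0 e1 eh; nra.
have ovXY : ov n (indep_sets n k) (bicliques n (k + 2)) <= A * (p / 2).
  have kk : (k <= k + 2 <= #|'I_n|)%N by rewrite card_ord kn2 leq_addr.
  apply: le_trans (overlap_spread R (isT : (0 < 2)%N) spY (proj1 spX) kk) _.
  rewrite card_ord -/L; apply: (@le_trans _ _ (B * (2 * B * h))).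
    have o0 : 0 <= overlap_sum R n k (k + 2) 2.
      by apply: sumr_ge0 => r _; apply: overlap_term_ge0.
    case/andP: wA' => x1 x2; apply: ler_pM => //.
    - exact: le_trans (ltW A0) x1.
    - by apply: mulr_ge0 => //; apply: mulr_ge0 => //; apply: ltW.
    - apply: ler_pM => //; last by rewrite ler_pM2l.
      by apply: mulr_ge0 => //; apply: ltW.
  by rewrite hE.
have loc (t theta : nat) (F : {set {set 'I_n} * {set 'I_n}}) (i : {set 'I_n} * {set 'I_n}) :
    (0 < theta)%N -> spread t theta F -> (2 <= t <= k + 2)%N -> (#|i.1| <= k + 2)%N ->
    E n t * theta%:R ^+ t <= B ->
    \sum_(j in F | meet2 i j) P n (bicoloured j) <= eta.
  move=> th0 sp /andP[t2 tk] ik EB.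
  have tn : (2 <= t <= n)%N by rewrite t2 (leq_trans tk).
  have lk : 36 ^+ 2 / c * k%:R ^+ 2 <= l * 2 ^+ k.
    rewrite -ler_pdivrMl // mulrC; apply: le_trans h2.
    by rewrite le_eqVlt; apply/orP; left; apply/eqP; field; rewrite !gt_eqF.
  apply: le_trans (dependent_weight_small th0 sp tn w c0 k0 tk ik lk) _.
  apply: (@le_trans _ _ (l * B)); first by rewrite ler_pM2l.
  by rewrite lE.
have sX i : i \in indep_sets n k -> (#|i.1| <= k + 2)%N.
  by move=> /(proj1 spX) ->; apply: leq_addr.
have sY i : i \in bicliques n (k + 2) -> (#|i.1| <= k + 2)%N.
  by move=> /(proj1 spY) ->.
have EB1 : E n k * 1%:R ^+ k <= B by rewrite expr1n mulr1 (le_trans Eb bB).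
have k22 : (2 <= k <= k + 2)%N by rewrite k2 leq_addr.
have k222 : (2 <= k + 2 <= k + 2)%N by rewrite leqnn leq_addl.
have [] := four_hit_patterns A0 wA' wA ovX ovY ovXY _ _ _ _ _ eta8 etaq.
- by move=> i /sX ik; apply: (loc k 1%N).
- by move=> i /sX ik; apply: (loc (k + 2)%N 2%N).
- by move=> i /sY ik; apply: (loc k 1%N).
- by move=> i /sY ik; apply: (loc (k + 2)%N 2%N).
- move=> i; rewrite inE /meet2 finset.setIid => /orP[/(proj1 spX)|/(proj1 spY)] -> //.
  by rewrite addn2.
rewrite -/p -/q => r1 r2 r3 r4; split.
- by apply: le_trans r1; rewrite ge_min lexx.
- by apply: le_trans r2; rewrite !ge_min lexx !orbT.
- by apply: le_trans r3; rewrite !ge_min lexx !orbT.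
- by apply: le_trans r4; rewrite !ge_min lexx !orbT.
Unshelve. all: by end_near. Qed.

End Asymptotics.

Section Conclusion.
Variable R : realType.
Implicit Types (n k : nat) (a b c K eps delta : R).
Notation E := (expected R).
Notation P n := (@Pr R (sgraph 'I_n)).

(** At p = 1/2 all graphs have the same weight, and the weights sum to 1. *)
Lemma Gnp_probE n (A : pred (sgraph 'I_n)) : Gnp_prob 2^-1 A = P n A.
Proof.
have w G : \prod_(e in vpairs 'I_n) (if e \in edges G then 2^-1 else 1 - 2^-1) = 2^-1 ^+ #|vpairs 'I_n| :> R.
  rewrite (eq_bigr (fun=> 2^-1)) ?prodr_const // => e _; case: ifP => // _; lra.
have total := @Gnp_total R 2^-1 n.
rewrite /Gnp_prob (eq_bigr _ (fun G _ => w G)) sumr_const in total.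
rewrite /Gnp_prob (eq_bigr _ (fun G _ => w G)) /Pr /Ex.
set x := 2^-1 ^+ _ in total *.
have N0 : #|{: sgraph 'I_n}|%:R != 0 :> R by rewrite pnatr_eq0 -lt0n card_sgraph_gt0.
apply: (mulIf N0); rewrite divfK // mulr_suml big_mkcond; apply: eq_bigr => G _.
case: (A G); rewrite ?mulr0n // mulr_natr; exact: total.
Qed.

Definition indep_hit n k := hits (independent_family 'I_n k).
Definition biclique_hit n m := hits (biclique_family 'I_n m).

Lemma alpha_ge n k (G : sgraph 'I_n) : (k <= alpha G)%N = indep_hit k G.
Proof. exact: alpha_geP. Qed.

Lemma beta_ge n m (G : sgraph 'I_n) : (2 <= m)%N -> (m <= beta G)%N = biclique_hit m G.
Proof. exact: beta_geP. Qed.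

(** Union bound. *)
Lemma Pr_all_four n eps (A1 A2 A3 A4 : pred (sgraph 'I_n)) :
  1 - eps <= P n A1 -> 1 - eps <= P n A2 -> P n A3 <= eps -> P n A4 <= eps ->
  P n (fun G => ~~ [&& A1 G, A2 G, ~~ A3 G & ~~ A4 G]) <= 4 * eps.
Proof.
move=> h1 h2 h3 h4.
have s1 : P n (fun G => ~~ [&& A1 G, A2 G, ~~ A3 G & ~~ A4 G]) <=
   P n (fun G => ~~ A1 G) + P n (fun G => ~~ [&& A2 G, ~~ A3 G & ~~ A4 G]).
  by apply: Pr_sub (card_sgraph_gt0 _) _ _ _ _ => G; case: (A1 G).
have s2 : P n (fun G => ~~ [&& A2 G, ~~ A3 G & ~~ A4 G]) <=
   P n (fun G => ~~ A2 G) + P n (fun G => ~~ [&& ~~ A3 G & ~~ A4 G]).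
  by apply: Pr_sub (card_sgraph_gt0 _) _ _ _ _ => G; case: (A2 G).
have s3 : P n (fun G => ~~ [&& ~~ A3 G & ~~ A4 G]) <= P n A3 + P n A4.
  by apply: Pr_sub (card_sgraph_gt0 _) _ _ _ _ => G; case: (A3 G); case: (A4 G).
have e1 : P n (fun G => ~~ A1 G) <= eps by rewrite (PrC R (card_sgraph_gt0 'I_n)) lerBlDl -lerBlDr.
have e2 : P n (fun G => ~~ A2 G) <= eps by rewrite (PrC R (card_sgraph_gt0 'I_n)) lerBlDl -lerBlDr.
apply: le_trans (le_trans s1 (lerD e1 (le_trans s2 (lerD e2 (le_trans s3 (lerD h3 h4)))))) _.
by clear; lra.
Qed.

(** The conditions listed say that alpha = k and beta = k + 2. *)
Lemma one_point_likely eps : 0 < eps ->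
  exists M, exists2 d, 0 < d & \forall k \near \oo, forall n, M <= E n k -> E n k.+1 <= d ->
  P n (fun G => ~~ [&& indep_hit k G, biclique_hit (k + 2) G, ~~ indep_hit k.+1 G &
    ~~ biclique_hit (k.+1 + 2) G]) <= eps.
Proof.
move=> eps0; pose c : R := (2 * expR 1 ^+ 2)^-1.
have c0 : 0 < c by rewrite invr_gt0 mulr_gt0 // exprn_gt0 // expR_gt0.
have e4 : 0 < eps / 4 by rewrite divr_gt0.
have f0 : 0 < 4 :> R by rewrite ltr0n.
have [M M0 hit] := hits_near_one c0 f0 e4.
exists (Num.max M 1); exists (Num.min 1 (eps / 32)); first by rewrite lt_min ltr01 divr_gt0.
apply: filter_app hit; near=> k => hit n ME Ed.
have k0 : (0 < k)%N by near: k; apply: nbhs_infty_gt.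
move: ME Ed; rewrite ge_max le_min => /andP[ME E1] /andP[E1' Ed].
have w : window c 4 n k by apply: window_of_crossing.
have [h1 h2] := hit n w ME.
have [l1 l2] := @hits_le R n k.+1 isT.
have Lu := plus2_upper (window_succ (ltW c0) (ltW f0) k0 w) (ltn0Sn k).
have -> : eps = 4 * (eps / 4) by field.
apply: Pr_all_four => //.
  by apply: le_trans l1 _; lra.
by apply: le_trans l2 _; lra.
Unshelve. all: by end_near. Qed.

(** If f(k+1) is of order 1 then f(k) is large and f(k+2) small, so alpha is k or
    k + 1 and beta is k + 2 or k + 3. *)
Lemma two_points_likely a b eps : 0 < a -> 0 < b -> 0 < eps ->
  \forall k \near \oo, forall n, a <= E n k.+1 <= b ->
  P n (fun G => ~~ [&& indep_hit k G, biclique_hit (k + 2) G, ~~ indep_hit k.+2 G &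
    ~~ biclique_hit (k.+2 + 2) G]) <= eps.
Proof.
move=> a0 b0 eps0.
have [c [K [c0 K0 win]]] := window_of_bounds a0 b0.
have K80 : 0 < 8 * K by rewrite mulr_gt0.
have e4 : 0 < eps / 4 by rewrite divr_gt0.
have [M M0 hit] := hits_near_one c0 K80 e4.
pose d : R := Num.min (eps / 4) (eps / (8 * K)) / b.
have d0 : 0 < d by rewrite divr_gt0 // lt_min e4 divr_gt0.
have db1 : d * b <= eps / 4 by rewrite /d divfK ?gt_eqF // ge_min lexx.
have db2 : 2 * K * (d * b) <= eps / 4.
  apply: (@le_trans _ _ (2 * K * (eps / (8 * K)))).
    by rewrite ler_pM2l ?mulr_gt0 // /d divfK ?gt_eqF // ge_min lexx orbT.
  by rewrite le_eqVlt; apply/orP; left; apply/eqP; field; rewrite gt_eqF.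
clearbody d.
have aM0 : 0 < a / M by rewrite divr_gt0.
have small := near_infty_add 1 (@succ_small R c K d K0 d0).
apply: filter_app hit; apply: filter_app (@succ_small R c (8 * K) (a / M) K80 aM0).
apply: filter_app small.
near=> k => small1 small0 hit n ab.
have k0 : (0 < k)%N by near: k; apply: nbhs_infty_gt.
have w1 := win n k.+1 (ltn0Sn k) ab.
have w := window_pred (ltW c0) (ltW K0) k0 w1.
have /andP[aE Eb] := ab.
have ME : M <= E n k.
  have := le_trans aE (small0 n w); rewrite mulrAC ler_pdivlMr // => h.
  by rewrite -(ler_pM2l a0).
have [h1 h2] := hit n w ME.
have [l1 l2] := @hits_le R n k.+2 isT.
have sm : E n k.+2 <= d * b.
  rewrite addn1 in small1; apply: le_trans (small1 n w1) _.
  by rewrite ler_pM2l.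
have Lu := plus2_upper (window_succ (ltW c0) (ltW K0) (ltn0Sn k) w1) (ltn0Sn k.+1).
have -> : eps = 4 * (eps / 4) by field.
apply: Pr_all_four => //.
  by apply: le_trans l1 _; lra.
apply: le_trans l2 _; apply: le_trans Lu _; apply: le_trans db2.
by rewrite ler_pM2l // mulr_gt0.
Unshelve. all: by end_near. Qed.

End Conclusion.

(** * Concentration of the parameters *)

Section Final.
Variable R : realType.
Implicit Types (n k : nat) (a b c K eps delta : R).
Notation E := (expected R).
Notation P n := (@Pr R (sgraph 'I_n)).
Notation pr n x y := (P n (fun G : sgraph 'I_n => (alpha G == x) && (beta G == y))).

Lemma four_values_lower n k delta eps :
  P n (fun G => ~~ [&& indep_hit k G, biclique_hit (k + 2) G, ~~ indep_hit k.+2 G &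
    ~~ biclique_hit (k.+2 + 2) G]) <= eps ->
  let X := @indep_hit n k.+1 in let Y := @biclique_hit n (k.+1 + 2) in
  [/\ delta <= P n (fun G => X G && Y G), delta <= P n (fun G => X G && ~~ Y G),
      delta <= P n (fun G => ~~ X G && Y G) & delta <= P n (fun G => ~~ X G && ~~ Y G)] ->
  [/\ delta - eps <= pr n k.+1 (k + 3)%N, delta - eps <= pr n k.+1 (k + 2)%N,
      delta - eps <= pr n k (k + 3)%N & delta - eps <= pr n k (k + 2)%N] /\
  1 - eps <= P n (fun G => [|| (alpha G == k.+1) && (beta G == k + 3)%N,
      (alpha G == k.+1) && (beta G == k + 2)%N,
      (alpha G == k) && (beta G == k + 3)%N | (alpha G == k) && (beta G == k + 2)%N]).
Proof.
have O0 := card_sgraph_gt0 'I_n.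
have sub (A B : pred (sgraph 'I_n)) x :
    (forall G, (k <= alpha G < k.+2)%N -> (k + 2 <= beta G < k + 4)%N -> A G -> B G) ->
    P n (fun G => ~~ [&& indep_hit k G, biclique_hit (k + 2) G, ~~ indep_hit k.+2 G &
    ~~ biclique_hit (k.+2 + 2) G]) <= eps ->
    x <= P n A -> x - eps <= P n B.
  move=> h bad xA; rewrite lerBlDr; apply: le_trans xA _.
  apply: le_trans (lerD (lexx _) bad); apply: (Pr_sub R O0) => G AG.
  apply/orP; case: (boolP (B G)) => nB; [by left|right].
  apply: contra nB => /and4P[a1 b1 a2 b2]; apply: h => //.
    by rewrite -alpha_ge in a1; rewrite -alpha_ge -ltnNge in a2; rewrite a1.
  rewrite -beta_ge ?addn2 // in b1; rewrite -beta_ge ?addn2 // -ltnNge in b2.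
  by rewrite addn2 b1 -[(k + 4)%N]addn0 !addnS !addn0.
move=> bad X Y [h1 h2 h3 h4].
have XE G : X G = (k.+1 <= alpha G)%N by rewrite alpha_ge.
have YE G : Y G = (k + 3 <= beta G)%N by rewrite /Y -beta_ge ?addn2 // !addnS addn0.
split; [split|].
- apply: sub bad h1 => G; rewrite XE YE; lia.
- apply: sub bad h2 => G; rewrite XE YE; lia.
- apply: sub bad h3 => G; rewrite XE YE; lia.
- apply: sub bad h4 => G; rewrite XE YE; lia.
- apply: (sub predT) bad _ => [G|]; last by rewrite (Pr1 R O0).
  by lia.
Qed.

Lemma near_comp (nu : nat -> nat) (Q : nat -> Prop) : nu @ \oo --> \oo ->
  (\forall n \near \oo, Q n) -> \forall i \near \oo, Q (nu i).
Proof. by move=> nu_oo; apply: nu_oo. Qed.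

(** Probabilities never exceed 1, so only lower bounds matter for the limit. *)
Lemma whp_of_near (nu : nat -> nat) (A : forall n, pred (sgraph 'I_n)) :
  (forall eps, 0 < eps -> \forall i \near \oo, 1 - eps <= P (nu i) (A (nu i))) ->
  whp (2^-1 : R) nu A.
Proof.
move=> h; apply/cvgrPdist_le => eps eps0; near=> i.
rewrite Gnp_probE ger0_norm ?subr_ge0 ?Pr_le1 ?card_sgraph_gt0 //.
by rewrite lerBlDr addrC -lerBlDr; near: i; apply: h.
Unshelve. all: by end_near. Qed.

(** The common form of the cases where f(kappa) is of order 1, for kappa equal
    to k0 or to k0 + 1. *)
Lemma two_point_concentration (nu kappa a1 a0 b2 b1 : nat -> nat) a b :
  nu @ \oo --> \oo -> (forall i, 0 < kappa (nu i))%N -> 0 < a -> 0 < b ->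
  (\forall i \near \oo, a <= E (nu i) (kappa (nu i)) <= b) ->
  (forall n, a1 n = kappa n) -> (forall n, a0 n = kappa n - 1)%N ->
  (forall n, b2 n = kappa n + 2)%N -> (forall n, b1 n = kappa n + 1)%N ->
  whp (2^-1 : R) nu (fun n G => [|| alpha_beta_eq a1 b2 G, alpha_beta_eq a1 b1 G,
    alpha_beta_eq a0 b2 G | alpha_beta_eq a0 b1 G]) /\
  [/\ bounded_away (fun i => Gnp_prob (2^-1 : R) (@alpha_beta_eq a1 b2 (nu i))),
      bounded_away (fun i => Gnp_prob (2^-1 : R) (@alpha_beta_eq a1 b1 (nu i))),
      bounded_away (fun i => Gnp_prob (2^-1 : R) (@alpha_beta_eq a0 b2 (nu i))) &
      bounded_away (fun i => Gnp_prob (2^-1 : R) (@alpha_beta_eq a0 b1 (nu i)))].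
Proof.
move=> nu_oo kap0 a0_ b0_ bnd ha1 ha0 hb2 hb1.
have [delta d0 four] := four_hit_patterns_likely a0_ b0_.
have [c [K [_ K0 win]]] := window_of_bounds a0_ b0_.
have kap_oo (Q : nat -> Prop) : (\forall k \near \oo, Q k) -> \forall i \near \oo, Q (kappa (nu i)).-1.
  case=> N _ hN; have := near_comp nu_oo (@window_infty R c K N.+1 K0).
  apply: filter_app; apply: filter_app bnd; near=> i => bi wi.
  by apply: hN; rewrite /= -ltnS prednK // ; apply: wi; apply: win.
have main eps : 0 < eps -> \forall i \near \oo, let n := nu i in
   [/\ delta - eps <= P n (@alpha_beta_eq a1 b2 n), delta - eps <= P n (@alpha_beta_eq a1 b1 n),
      delta - eps <= P n (@alpha_beta_eq a0 b2 n) & delta - eps <= P n (@alpha_beta_eq a0 b1 n)] /\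
   1 - eps <= P n (fun G => [|| alpha_beta_eq a1 b2 G, alpha_beta_eq a1 b1 G,
    alpha_beta_eq a0 b2 G | alpha_beta_eq a0 b1 G]).
  move=> eps0; apply: filter_app bnd.
  apply: filter_app (kap_oo _ (two_points_likely a0_ b0_ eps0)).
  apply: filter_app (kap_oo _ (near_infty_add 1 four)).
  near=> i; rewrite addn1 !prednK // => four_i bad_i bi.
  have ek := prednK (kap0 i).
  have := @four_values_lower (nu i) (kappa (nu i)).-1 delta eps.
  rewrite ek => /(_ (bad_i _ bi) (four_i _ bi)).
  have -> : ((kappa (nu i)).-1 + 3 = b2 (nu i))%N by rewrite hb2 -ek; lia.
  have -> : ((kappa (nu i)).-1 + 2 = b1 (nu i))%N by rewrite hb1 -ek; lia.
  by rewrite -subn1 -ha0 -ha1.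
have disj n (x y x' y' : nat) : (x, y) != (x', y') -> pr n x y + pr n x' y' <= 1.
  move=> ne; rewrite -ExD -[leRHS](Ex1 R (card_sgraph_gt0 'I_n)).
  apply: (Ex_le (card_sgraph_gt0 'I_n)) => G /=. rewrite -natrD (ler_nat _ _ 1).
  case: andP => [[/eqP ex /eqP ey]|_]; case: andP => [[/eqP ex' /eqP ey']|_] //.
  by rewrite -ex -ey -ex' -ey' eqxx in ne.
have d20 : 0 < delta / 2 by rewrite divr_gt0.
have away (x y x' y' : nat -> nat) : (forall i, (x (nu i), y (nu i)) != (x' (nu i), y' (nu i))) ->
    (\forall i \near \oo, delta / 2 <= P (nu i) (@alpha_beta_eq x y (nu i))) ->
    (\forall i \near \oo, delta / 2 <= P (nu i) (@alpha_beta_eq x' y' (nu i))) ->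
    bounded_away (fun i => Gnp_prob (2^-1 : R) (@alpha_beta_eq x y (nu i))).
  move=> ne h h'; exists (delta / 2) => //; apply: filter_app h; apply: filter_app h'.
  near=> i => h' h; rewrite Gnp_probE h /=.
  have := disj (nu i) _ _ _ _ (ne i).
  rewrite -/(P (nu i) (@alpha_beta_eq x y (nu i))) -/(P (nu i) (@alpha_beta_eq x' y' (nu i))).
  by rewrite lerBrDr; apply: le_trans; rewrite lerD2l.
have m4 := main _ d20.
have dd : delta - delta / 2 = delta / 2 by field.
have ne12 : forall i, (a1 (nu i), b2 (nu i)) != (a1 (nu i), b1 (nu i)).
  by move=> i; rewrite xpair_eqE hb2 hb1 eqn_add2l andbF.
have ne34 : forall i, (a0 (nu i), b2 (nu i)) != (a0 (nu i), b1 (nu i)).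
  by move=> i; rewrite xpair_eqE hb2 hb1 eqn_add2l andbF.
have q1 : \forall i \near \oo, delta / 2 <= P (nu i) (@alpha_beta_eq a1 b2 (nu i)).
  by apply: filterS m4 => i /= [[]]; rewrite dd.
have q2 : \forall i \near \oo, delta / 2 <= P (nu i) (@alpha_beta_eq a1 b1 (nu i)).
  by apply: filterS m4 => i /= [[]]; rewrite dd.
have q3 : \forall i \near \oo, delta / 2 <= P (nu i) (@alpha_beta_eq a0 b2 (nu i)).
  by apply: filterS m4 => i /= [[]]; rewrite dd.
have q4 : \forall i \near \oo, delta / 2 <= P (nu i) (@alpha_beta_eq a0 b1 (nu i)).
  by apply: filterS m4 => i /= [[]]; rewrite dd.
split.
  by apply: whp_of_near => eps eps0; apply: filterS (main _ eps0) => i /= [].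
split.
- exact: away ne12 q1 q2.
- by apply: away q2 q1 => i; rewrite eq_sym.
- exact: away ne34 q3 q4.
- by apply: away q4 q3 => i; rewrite eq_sym.
Unshelve. all: by end_near. Qed.

End Final.

Theorem theorem1p1 (R : realType) (nu : nat -> nat)
  (nu_gt0 : forall i, (0 < nu i)%N) (nu_oo : nu @ \oo --> \oo) :
  [/\
      (fun i => fk R (nu i) (k0 R (nu i))) @ \oo --> +oo ->
      (fun i => fk R (nu i) (k0 R (nu i)).+1) =o_\oo (fun=> 1 : R) ->
      whp (2^-1 : R) nu (alpha_beta_eq (k0 R) (fun n => k0 R n + 2)%N) /\
      whp (2^-1 : R) nu
        (fun n G => (tau G)%:Z <= n%:Z - (alpha G)%:Z - 1),
      (fun i => fk R (nu i) (k0 R (nu i))) =Theta_\oo (fun=> 1 : R) ->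
      let a := alpha_beta_eq (k0 R) (fun n => k0 R n + 2)%N in
      let b := alpha_beta_eq (k0 R) (fun n => k0 R n + 1)%N in
      let c := alpha_beta_eq (fun n => k0 R n - 1)%N (fun n => k0 R n + 2)%N in
      let d := alpha_beta_eq (fun n => k0 R n - 1)%N (fun n => k0 R n + 1)%N in
      whp (2^-1 : R) nu (fun n G => [|| a n G, b n G, c n G | d n G]) /\
      [/\ bounded_away (fun i => Gnp_prob (2^-1 : R) (a (nu i))),
          bounded_away (fun i => Gnp_prob (2^-1 : R) (b (nu i))),
          bounded_away (fun i => Gnp_prob (2^-1 : R) (c (nu i))) &
          bounded_away (fun i => Gnp_prob (2^-1 : R) (d (nu i)))] &
      (fun i => fk R (nu i) (k0 R (nu i)).+1) =Theta_\oo (fun=> 1 : R) ->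
      let a := alpha_beta_eq (fun n => k0 R n + 1)%N (fun n => k0 R n + 3)%N in
      let b := alpha_beta_eq (fun n => k0 R n + 1)%N (fun n => k0 R n + 2)%N in
      let c := alpha_beta_eq (k0 R) (fun n => k0 R n + 3)%N in
      let d := alpha_beta_eq (k0 R) (fun n => k0 R n + 2)%N in
      whp (2^-1 : R) nu (fun n G => [|| a n G, b n G, c n G | d n G]) /\
      [/\ bounded_away (fun i => Gnp_prob (2^-1 : R) (a (nu i))),
          bounded_away (fun i => Gnp_prob (2^-1 : R) (b (nu i))),
          bounded_away (fun i => Gnp_prob (2^-1 : R) (c (nu i))) &
          bounded_away (fun i => Gnp_prob (2^-1 : R) (d (nu i)))]].
Proof.
have k0_gt0 i : (0 < k0 R (nu i))%N.
  have [_] := k0P R (nu i); apply.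
  by rewrite /fk bin1 expr0 invr1 mulr1 ler1n.
have Theta (u : nat -> R) : u =Theta_\oo (fun=> 1 : R) -> (forall i, 0 <= u i) ->
    exists a b, [/\ 0 < a, 0 < b & \forall i \near \oo, a <= u i <= b].
  rewrite eqThetaE qualifE => /asboolP[[a b] /= /andP[a0 b0] h] u0.
  exists a, b; split=> //; apply: filterS h => i [].
  by rewrite normr1 !mulr1 ger0_norm // => -> ->.
split.
- move=> f_oo f_o.
  have big M : \forall i \near \oo, M <= expected R (nu i) (k0 R (nu i)).
    by move/cvgryPge: f_oo => /(_ M); apply: filterS => i; rewrite fkE.
  have small d : 0 < d -> \forall i \near \oo, expected R (nu i) (k0 R (nu i)).+1 <= d.
    move=> d0; move/eqoP: f_o => /(_ d d0); apply: filterS => i.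
    by rewrite normr1 mulr1 fkE; apply: le_trans; apply: ler_norm.
  have k0_oo (Q : nat -> Prop) : (\forall k \near \oo, Q k) ->
      \forall i \near \oo, Q (k0 R (nu i)).
    case=> N _ hN; have f0 : 0 < 4 :> R by rewrite ltr0n.
    have := near_comp nu_oo (@window_infty R (2 * expR 1 ^+ 2)^-1 4 N f0).
    apply: filter_app; apply: filter_app (big 1); apply: filter_app (small 1 ltr01).
    near=> i => s1 b1 w; apply: hN; apply: w; exact: window_of_crossing.
  have main eps : 0 < eps -> \forall i \near \oo,
      1 - eps <= Pr R (@alpha_beta_eq (k0 R) (fun n => k0 R n + 2)%N (nu i)).
    move=> eps0; have [M [d d0 one]] := @one_point_likely R eps eps0.
    apply: filter_app (k0_oo _ one); apply: filter_app (big M); apply: filter_app (small d d0).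
    near=> i => sd bM /(_ _ bM sd) bad.
    have O0 := card_sgraph_gt0 'I_(nu i).
    rewrite lerBlDr -(Pr1 R O0); apply: le_trans (lerD (lexx _) bad).
    apply: (Pr_sub R O0) => G _; rewrite orbC -implybE; apply/implyP.
    rewrite -!alpha_ge -!beta_ge ?addn2 // /alpha_beta_eq addn2.
    by move=> /and4P[]; lia.
  split; first exact: whp_of_near.
  apply: whp_of_near => eps eps0; apply: filterS (main _ eps0) => i /le_trans -> //.
  apply: (Pr_le R (card_sgraph_gt0 _)) => G /andP[/eqP aG /eqP bG].
  have b0 : (0 < beta G)%N by rewrite bG addn2.
  have := tau_le_beta b0; rewrite aG bG card_ord; lia.
- move=> /Theta[|a [b [a0 b0 ab]]]; first by move=> i; rewrite fkE expected_ge0.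
  apply: (@two_point_concentration R nu (k0 R) _ _ _ _ a b) => //.
  by apply: filterS ab => i; rewrite fkE.
- move=> /Theta[|a [b [a0 b0 ab]]]; first by move=> i; rewrite fkE expected_ge0.
  apply: (@two_point_concentration R nu (fun n => (k0 R n).+1) _ _ _ _ a b) => //.
  + by apply: filterS ab => i; rewrite fkE.
  + by move=> n; rewrite addn1.
  + by move=> n; rewrite subn1.
  + by move=> n; rewrite addSnnS.
  + by move=> n; rewrite addSnnS.
Unshelve. all: by end_near. Qed.
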